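(* Let $X$ be a locally finite building of finite rank. The minimal combinatorial compactification $\mathscr{C}_1(X)$ is $\mathrm{Aut}(X)$-equivariantly homeomorphic to the horofunction compactification of the chamber graph of $X$ (the set $\mathrm{Ch}(X)$ of chambers endowed with the gallery distance). Similarly, the maximal combinatorial compactification $\mathscr{C}_{\mathrm{sph}}(X)$ is $\mathrm{Aut}(X)$-equivariantly homeomorphic to the horofunction compactification of the set $\mathrm{Res}_{\mathrm{sph}}(X)$ of spherical residues endowed with the root-distance.
   Context: Conventions on buildings. $X$ is a building of finite rank and of arbitrary type $(W,S)$. A residue of type $J\subset S$ is spherical if $W_J=\langle J\rangle$ is finite. Residues are viewed as simplices: we write $R\subset R'$ if, as sets of chambers, $R'$ is a subset of $R$; thus chambers are the maximal spherical residues and panels are the rank one residues. $\mathrm{Ch}(X)$, $\mathrm{Res}_1(X)$, $\mathrm{Res}_{\mathrm{sph}}(X)$ denote the sets of chambers, panels and spherical residues. The star $\mathrm{St}(\sigma)$ is the set of residues $R$ with $\sigma\subset R$ (including $\sigma$). For a chamber $C$, $\mathrm{proj}_\sigma(C)$ is the unique chamber of $\mathrm{St}(\sigma)$ nearest to $C$ for the gallery distance; for a spherical residue $R$, $\mathrm{proj}_\sigma(R)\in\mathrm{St}(\sigma)$ is the residue whose set of chambers is $\{\mathrm{proj}_\sigma(C) : C \text{ a chamber with } R\subset C\}$. $X$ is locally finite if stars of spherical residues are finite. Combinatorial compactifications. $\mathscr{C}_1(X)$ is the closure of the image of $\mathrm{Ch}(X)\to\prod_{\sigma\in\mathrm{Res}_1(X)}\mathrm{St}(\sigma)$,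 $C\mapsto(\sigma\mapsto\mathrm{proj}_\sigma(C))$, and $\mathscr{C}_{\mathrm{sph}}(X)$ is the closure of the image of $\mathrm{Res}_{\mathrm{sph}}(X)\to\prod_{\sigma\in\mathrm{Res}_{\mathrm{sph}}(X)}\mathrm{St}(\sigma)$, $R\mapsto(\sigma\mapsto\mathrm{proj}_\sigma(R))$; stars are discrete and products carry the product topology. $\mathrm{Aut}(X)$ acts by $(g f)(\sigma)=g f(g^{-1}\sigma)$. Root-distance. A half-apartment $\alpha$ of an apartment $A$ contains a residue $R$ of $A$ if some chamber of $A$ containing $R$ lies in $\alpha$. For $R_1,R_2\in\mathrm{Res}_{\mathrm{sph}}(X)$ and an apartment $A$ containing both, $\Phi_A(R_1,R_2)$ is the set of half-apartments of $A$ containing $R_1$ but not $R_2$, and $d(R_1,R_2)=\frac12|\Phi_A(R_1,R_2)|+\frac12|\Phi_A(R_2,R_1)|$; this does not depend on $A$, is a metric, and restricts to the gallery distance on chambers. Horofunction compactification. For a proper metric space $(Y,d)$ and $y_0\in Y$, let $\mathscr F(Y,y_0)$ be the compact space of $1$-Lipschitz functions $Y\to\mathbb R$ vanishing at $y_0$, with the topology of pointwise convergence. The horofunction compactification of $Y$ is the closure in $\mathscr F(Y,y_0)$ of $\{f_p : p\in Y\}$, where $f_p(y)=d(p,y)-d(p,y_0)$. Identifying $\mathscr F(Y,y_0)$ with $1$-Lipschitz functions modulo constants, it is independent of $y_0$ and isometries $g$ of $Y$ act by $f\mapsto f\circ g^{-1}$ modulo constants. *)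

(* Defs.v *)
From HB Require Import structures.
From mathcomp Require Import all_boot all_order all_algebra finmap.
From mathcomp Require Import all_classical all_reals topology normedtype.

Set Implicit Arguments.
Unset Strict Implicit.
Unset Printing Implicit Defensive.

Import Order.TTheory GRing.Theory Num.Theory.
Import numFieldNormedType.Exports.
Local Open Scope classical_set_scope.
Local Open Scope ring_scope.

(** The least natural number satisfying [P] ([0] if there is none). *)
Definition least (P : set nat) : nat :=
  xget 0%N [set n | P n /\ forall m, P m -> (n <= m)%N].

(** * Coxeter systems of finite rank *)

Definition coxeter_matrix (S : finType) (m : S -> S -> nat) : Prop :=
  [/\ forall s, m s s = 1%N, forall s t, m s t = m t s
    & forall s t, s != t -> m s t <> 1%N].

(** The congruence on words generated by [(s t)^(m s t) ~ 1]. The value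
    [m s t = 0] encodes infinite order: the corresponding relation is void. *)
Inductive coxeter_equiv (S : finType) (m : S -> S -> nat) :
    seq S -> seq S -> Prop :=
| coxeter_refl u : coxeter_equiv m u u
| coxeter_sym u v : coxeter_equiv m u v -> coxeter_equiv m v u
| coxeter_trans u v w :
    coxeter_equiv m u v -> coxeter_equiv m v w -> coxeter_equiv m u w
| coxeter_rel u v s t :
    coxeter_equiv m (u ++ flatten (nseq (m s t) [:: s; t]) ++ v) (u ++ v).

Definition word_prod (S : finType) (W : groupType) (gen : S -> W) (u : seq S) : W :=
  (\big[*%g/1]_(s <- u) gen s)%g.

(** [W] is the group presented by [<S | (s t)^(m s t) = 1>]. *)
Record coxeter_system := CoxeterSystem {
  cox_gen : finType;
  cox_mat : cox_gen -> cox_gen -> nat;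
  cox_group :> groupType;
  cox_emb : cox_gen -> cox_group;
  cox_matP : coxeter_matrix cox_mat;
  cox_surj : forall w, exists u, word_prod cox_emb u = w;
  cox_pres : forall u v, word_prod cox_emb u = word_prod cox_emb v <->
                         coxeter_equiv cox_mat u v
}.

Section Coxeter.
Variable W : coxeter_system.

Definition cox_length (w : W) : nat :=
  least [set n | exists2 u, size u = n & word_prod (@cox_emb W) u = w].

Definition parabolic (J : {set cox_gen W}) : set W :=
  [set w | exists2 u, all (mem J) u & word_prod (@cox_emb W) u = w].

Definition cox_aut (phi : W -> W) : Prop :=
  [/\ bijective phi, forall x y, phi (x * y)%g = (phi x * phi y)%g
    & exists2 pi : cox_gen W -> cox_gen W, bijective pi
      & forall s, phi (cox_emb s) = cox_emb (pi s)].
End Coxeter.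

(** * Buildings of type [(W, S)], as sets of chambers with a Weyl distance *)

Record building (W : coxeter_system) := Building {
  chamber :> choiceType;
  wdist : chamber -> chamber -> W;
  chamber_ex : exists c : chamber, True;
  wdist1 : forall c d, wdist c d = 1%g <-> c = d;
  wdistW : forall c' c d s, wdist c' c = cox_emb s ->
    wdist c' d = (cox_emb s * wdist c d)%g \/ wdist c' d = wdist c d;
  wdistL : forall c' c d s, wdist c' c = cox_emb s ->
    cox_length (cox_emb s * wdist c d)%g = (cox_length (wdist c d)).+1 ->
    wdist c' d = (cox_emb s * wdist c d)%g;
  wdistE : forall c d s, exists2 c', wdist c' c = cox_emb s
    & wdist c' d = (cox_emb s * wdist c d)%g
}.

Section Building.
Variables (W : coxeter_system) (X : building W).
Implicit Types c d : X.

Definition adjacent c d : Prop := exists s, wdist c d = cox_emb s.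

Definition gallery_dist c d : nat :=
  least [set n | exists p : seq X,
    [/\ size p = n, path (fun x y => `[< adjacent x y >]) c p & last c p = d]].

(** Residues are represented by their sets of chambers; chambers are the
    singletons. As simplices, [sigma] is a face of [R] iff [R `<=` sigma]. *)
Definition residue_of (J : {set cox_gen W}) c : set X :=
  [set d | parabolic J (wdist c d)].

Definition residue : set (set X) :=
  [set A | exists J c, A = residue_of J c].

Definition Res_sph : set residue :=
  [set R | exists J c, finite_set (parabolic J) /\ val R = residue_of J c].

Definition Res_1 : set residue :=
  [set R | exists s c, val R = residue_of [set s]%SET c].

Definition star (sigma : residue) : set residue :=
  [set R | val R `<=` val sigma].

Definition locally_finite : Prop :=
  forall sigma, Res_sph sigma -> finite_set (star sigma).

(** ** Projections *)

Definition nearest (sigma : residue) c : set X :=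
  [set d | val sigma d /\
    forall e, val sigma e -> (gallery_dist c d <= gallery_dist c e)%N].

Definition star_self (sigma : residue) : star sigma :=
  SigSub (mem_set (@subset_refl X (val sigma)) : sigma \in star sigma).

(** The element of [star sigma] whose chambers are the projections of those of
    [A]. It exists when [A] is a residue; [sigma] is a junk value otherwise. *)
Definition proj (sigma : residue) (A : set X) : star sigma :=
  xget (star_self sigma)
    [set P | val (val P) = [set d | exists2 c, A c & nearest sigma c d]].

(** ** Combinatorial compactifications *)

Definition star_prod (I : set residue) : Type :=
  prod_topology (fun sigma : I => discrete_topology (star (val sigma))).
HB.instance Definition _ (I : set residue) := 
  Topological.copy (star_prod I)
    (prod_topology (fun sigma : I => discrete_topology (star (val sigma)))).

Definition proj_map (I : set residue) (A : set X) : star_prod I :=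
  fun sigma => proj (val sigma) A.
Arguments proj_map : clear implicits.

Definition C_1 : set (star_prod Res_1) :=
  closure (range (fun c => proj_map Res_1 [set c])).

Definition C_sph : set (star_prod Res_sph) :=
  closure (range (fun R : Res_sph => proj_map Res_sph (val (val R)))).

(** ** Root-distance *)

Definition apartment : set (set X) :=
  [set A | exists2 phi : W -> X,
    (forall x y, wdist (phi x) (phi y) = (x^-1 * y)%g) & A = range phi].

Definition half_apartment (A : set X) : set (set X) :=
  [set alpha | exists c d, [/\ A c, A d, adjacent c d &
    alpha = [set x | A x /\ (gallery_dist x c < gallery_dist x d)%N]]].

(** Applied to an apartment or to a half-apartment [A]. *)
Definition contains (A : set X) (R : residue) : Prop :=
  exists c, A c /\ val R c.

Definition Phi (A : set X) (R1 R2 : residue) : set (set X) :=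
  [set alpha | [/\ half_apartment A alpha, contains alpha R1
                 & ~ contains alpha R2]].

(** Computed in an arbitrary apartment containing both residues: the value
    does not depend on it. *)
Definition root_dist (R : realType) (R1 R2 : residue) : R :=
  xget 0 [set r | exists A, [/\ apartment A, contains A R1, contains A R2 &
    r = 2^-1 * (#|` fset_set (Phi A R1 R2)|)%:R +
        2^-1 * (#|` fset_set (Phi A R2 R1)|)%:R]].

(** ** Automorphisms, not necessarily type-preserving *)

Record building_aut := BuildingAut {
  aut_fun :> X -> X;
  aut_inv : X -> X;
  aut_funK : cancel aut_fun aut_inv;
  aut_invK : cancel aut_inv aut_fun;
  aut_wdist : exists2 phi : W -> W, cox_aut phi
    & forall c d, wdist (aut_fun c) (aut_fun d) = phi (wdist c d)
}.

Lemma aut_wdistV (g : building_aut) : exists2 phi : W -> W, cox_aut phi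
  & forall c d, wdist (aut_inv g c) (aut_inv g d) = phi (wdist c d).
Proof.
case: (aut_wdist g) => phi [[psi pK Kp] phiM [pi [rho piK Kpi] piE]] phig.
exists psi.
  split; first by exists phi.
  - by move=> x y; apply: (can_inj pK); rewrite phiM !Kp.
  - exists rho; first by exists pi.
    by move=> s; apply: (can_inj pK); rewrite Kp piE Kpi.
by move=> c d; apply: (can_inj pK); rewrite Kp -phig !aut_invK.
Qed.

Definition autV (g : building_aut) : building_aut :=
  BuildingAut (@aut_invK g) (@aut_funK g) (aut_wdistV g).

Lemma aut_parabolic (phi : W -> W) (pi : cox_gen W -> cox_gen W)
    (J : {set cox_gen W}) :
  (forall x y, phi (x * y)%g = (phi x * phi y)%g) ->
  (forall s, phi (cox_emb s) = cox_emb (pi s)) -> injective phi ->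
  phi @` parabolic J = parabolic (pi @: J)%SET.
Proof.
move=> phiM piE phiI.
have phi1 : phi 1%g = 1%g.
  by apply: (@mulgI W (phi 1%g)); rewrite -phiM !mulg1.
have phiW u : phi (word_prod (@cox_emb W) u) =
    word_prod (@cox_emb W) (map pi u).
  elim: u => [|s u IHu]; first by rewrite /word_prod !big_nil phi1.
  by move: IHu; rewrite /word_prod /= !big_cons phiM piE => ->.
apply/seteqP; split => [_ [_ [u uJ <-] <-]|_ [u uJ <-]].
  exists (map pi u); last by rewrite phiW.
  by rewrite all_map; apply: sub_all uJ => s sJ /=; apply: imset_f.
have [v vJ ->] : exists2 v, all (mem J) v & u = map pi v.
  elim: u uJ => [|s u IHu] /=; first by exists [::].
  case/andP=> /imsetP[t tJ ->] /IHu[v vJ ->].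
  by exists (t :: v) => //=; apply/andP.
exists (word_prod (@cox_emb W) v); last by rewrite phiW.
by exists v.
Qed.

Lemma aut_residue_of (g : building_aut) : exists2 phi : W -> W, injective phi &
  exists pi : cox_gen W -> cox_gen W, forall J,
    phi @` parabolic J = parabolic (pi @: J)%SET /\
    forall c, g @` residue_of J c = residue_of (pi @: J)%SET (g c).
Proof.
case: (aut_wdist g) => phi [/bij_inj phiI phiM [pi _ piE]] phig.
exists phi => //; exists pi => J; have pJ := aut_parabolic J phiM piE phiI.
split=> // c; apply/seteqP; split => [_ [d dJ <-]|d dJ].
  by rewrite /residue_of /= phig -pJ; exists (wdist c d).
exists (aut_inv g d); last exact: aut_invK.
move: dJ; rewrite /residue_of /= -pJ => -[w wJ].
by rewrite -{1}(aut_invK g d) phig => /phiI <-.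
Qed.

Lemma aut_residue (g : building_aut) (R : residue) :
  g @` val R \in residue.
Proof.
case: R => A /= /set_mem[J [c ->]]; apply/mem_set.
have [phi _ [pi /(_ J)[_ /(_ c) ->]]] := aut_residue_of g.
by exists (pi @: J)%SET, (g c).
Qed.

Definition aut_res (g : building_aut) (R : residue) : residue :=
  SigSub (aut_residue g R).

Lemma aut_resK (g : building_aut) R : aut_res g (aut_res (autV g) R) = R.
Proof.
apply: val_inj; apply/seteqP; split => /= [_ [_ [c Rc <-] <-]|c Rc].
  by rewrite /= aut_invK.
by exists (aut_inv g c); [exists c|rewrite aut_invK].
Qed.

(** A set of residues preserved by all automorphisms. *)
Definition aut_stable (I : set residue) : Prop :=
  forall g R, R \in I -> aut_res g R \in I.

Lemma aut_stable_1 : aut_stable Res_1.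
Proof.
move=> g R /set_mem[s [c Rsc]]; apply/mem_set.
have [phi _ [pi /(_ [set s]%SET)[_ /(_ c)]]] := aut_residue_of g.
by rewrite imset_set1 -Rsc => E; exists (pi s), (g c).
Qed.

Lemma aut_stable_sph : aut_stable Res_sph.
Proof.
move=> g R /set_mem[J [c [finJ RJc]]]; apply/mem_set.
have [phi _ [pi /(_ J)[pJ /(_ c) E]]] := aut_residue_of g.
exists (pi @: J)%SET, (g c); split; last by rewrite -E -RJc.
by rewrite -pJ; apply: finite_image.
Qed.

Definition aut_act (I : set residue) (sI : aut_stable I)
    (g : building_aut) (sigma : I) : I :=
  SigSub (sI g (val sigma) (valP sigma)).

Lemma aut_star (g : building_aut) (sigma : residue)
    (P : star (aut_res (autV g) sigma)) : aut_res g (val P) \in star sigma.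
Proof.
case: P => P /= /set_mem Psub; apply/mem_set => _ [c /Psub[d sd <-] <-] /=.
by rewrite aut_invK.
Qed.

(** [(g f)(sigma) = g f(g^-1 sigma)] *)
Definition prod_act (I : set residue) (sI : aut_stable I)
    (g : building_aut) (f : star_prod I) : star_prod I :=
  fun sigma => SigSub (aut_star (f (aut_act sI (autV g) sigma))).

End Building.

Arguments Res_1 {W} X.
Arguments Res_sph {W} X.
Arguments C_1 {W} X.
Arguments C_sph {W} X.
Arguments aut_stable_1 {W} X.
Arguments aut_stable_sph {W} X.
Arguments locally_finite {W} X.

(** * Horofunction compactification *)

Section Horofunction.
Variables (R : realType) (Y : Type) (dist : Y -> Y -> R) (y0 : Y).

Definition lipschitz1_at : set {ptws Y -> R} :=
  [set f | f y0 = 0 /\ forall x y, `|f x - f y| <= dist x y].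

Definition dist_fun (p : Y) : {ptws Y -> R} := fun y => dist p y - dist p y0.

(** The closure is taken in [lipschitz1_at], with the topology of pointwise
    convergence. *)
Definition horofunction_compactification : set {ptws Y -> R} :=
  closure (range dist_fun : set (subspace lipschitz1_at)).

(** The action [f |-> f \o g^-1] on functions modulo constants, in terms of the
    representatives vanishing at [y0]; [gV] stands for [g^-1]. *)
Definition horo_act (gV : Y -> Y) (f : {ptws Y -> R}) : {ptws Y -> R} :=
  fun y => f (gV y) - f (gV y0).

End Horofunction.

Definition homeomorphism_on (E F : topologicalType) (A : set E) (B : set F)
    (h : E -> F) : Prop :=
  exists k : F -> E, [/\ {homo h : x / A x >-> B x}, {homo k : y / B y >-> A y},
    {in A, cancel h k} /\ {in B, cancel k h},
    {within A, continuous h} & {within B, continuous k}].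

(* Main.v *)
Require Import Defs.
From HB Require Import structures.
From mathcomp Require Import all_boot all_order all_algebra finmap.
From mathcomp Require Import zify lra.
From mathcomp Require Import all_classical all_reals topology normedtype.

Set Implicit Arguments.
Unset Strict Implicit.
Unset Printing Implicit Defensive.

Import Order.TTheory GRing.Theory Num.Theory.
Import numFieldNormedType.Exports.
Local Open Scope classical_set_scope.
Local Open Scope ring_scope.

(** A horofunction of the chamber graph is determined by its
    differences along panels, and on a panel [sigma] the function [d(C, .)]
    takes its minimum exactly at the projection of [C] (the gate property); so
    each value of [d(C, .) - d(C, C0)] is determined by finitely many
    projections of [C], and conversely. Both compactifications are therefore
    limits of the same data.

    For spherical residues the root-distance plays the same role. In an
    apartment, counting walls shows that the number of roots containing [R] but
    not [Q] is the directed Hausdorff distance ([excess]) from [R] to [Q] for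
    the gallery distance. Hence the root-distance is half the sum of the two
    excesses: it does not depend on the apartment, it satisfies the triangle
    inequality, and it is invariant under automorphisms. Sorting walls according
    to whether they cut [sigma] gives, for [Q] in the star of [sigma] and
    [P = proj_sigma R],
      [d(R, Q) - d(R, sigma) = d(P, Q) - d(P, sigma)],
    so that [P] determines [d(R, .)] on the star of [sigma] up to a constant;
    it is recovered from it as the unique minimum. *)

Lemma leastP (P : set nat) n : P n -> P (least P) /\ (least P <= n)%N.
Proof.
move=> Pn; have exP : exists m, `[< P m >] by exists n; apply/asboolP.
have [m /asboolP Pm mmin] := ex_minnP exP.
have Q : P m /\ forall k, P k -> (m <= k)%N.
  by split=> // k Pk; apply/mmin/asboolP.
rewrite /least; case: xgetP => [x _ [Px xmin]|/(_ m)//].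
by split=> //; apply: xmin.
Qed.

(** * Reflections in Coxeter groups *)

Section CoxeterGroup.
Local Open Scope group_scope.
Variable W : coxeter_system.
Local Notation S := (cox_gen W).
Local Notation wprod := (word_prod (@cox_emb W)).
Local Notation len := (@cox_length W).
Implicit Types (u v : seq S) (s : S) (w x y z t r : W) (J K : {set S}).

Lemma wprod0 : wprod [::] = 1.
Proof. by rewrite /word_prod big_nil. Qed.

Lemma wprod_cons s u : wprod (s :: u) = cox_emb s * wprod u.
Proof. by rewrite /word_prod big_cons. Qed.

Lemma wprod_cat u v : wprod (u ++ v) = wprod u * wprod v.
Proof. by rewrite /word_prod big_cat. Qed.

Lemma embK s : cox_emb s * cox_emb s = 1.
Proof.
have /cox_pres := coxeter_rel (@cox_mat W) [::] [::] s s.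
have [-> _ _] := cox_matP W.
by rewrite /= !wprod_cons wprod0 mulg1.
Qed.

Lemma embV s : (cox_emb s)^-1 = cox_emb s.
Proof. exact/mulg1_eq/embK. Qed.

Lemma wprod_rev u : wprod (rev u) = (wprod u)^-1.
Proof.
elim: u => [|s u IHu]; first by rewrite /rev wprod0 invg1.
by rewrite rev_cons -cats1 wprod_cat IHu !wprod_cons wprod0 mulg1 invgM embV.
Qed.

(** The reflections whose walls are crossed by the gallery of type [u] issued
    from [1]. *)
Fixpoint refls u : seq W :=
  if u is s :: u' then
    cox_emb s :: [seq cox_emb s * r * cox_emb s | r <- refls u']
  else [::].

Definition parity u t : bool := odd (count_mem t (refls u)).

Lemma size_refls u : size (refls u) = size u.
Proof. by elim: u => //= s u IHu; rewrite size_map IHu. Qed.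

Lemma conj_embK s : cancel (fun r => cox_emb s * r * cox_emb s)
  (fun r => cox_emb s * r * cox_emb s).
Proof. by move=> r; rewrite !mulgA embK mul1g -mulgA embK mulg1. Qed.

Lemma parity_cons s u t :
  parity (s :: u) t =
    (t == cox_emb s) (+) parity u (cox_emb s * t * cox_emb s).
Proof.
rewrite /parity /= oddD count_map; congr (_ (+) odd _).
  by rewrite eq_sym; case: (_ == _).
apply: eq_count => r /=.
exact: (can2_eq (conj_embK s) (conj_embK s)).
Qed.

Lemma parity_cat u v t :
  parity (u ++ v) t = parity u t (+) parity v ((wprod u)^-1 * t * wprod u).
Proof.
elim: u t => [|s u IHu] t.
  by rewrite wprod0 invg1 mul1g mulg1.
by rewrite cat_cons !parity_cons IHu addbA wprod_cons invgM embV !mulgA.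
Qed.

Lemma refls_alternating s s' n :
  refls (flatten (nseq n [:: s; s'])) =
    [seq (cox_emb s * cox_emb s') ^+ i * cox_emb s | i <- iota 0 (n + n)].
Proof.
elim: n => [//|n IHn]; rewrite addSn addnS /= IHn.
have -> : iota 2 (n + n) = [seq (2 + i)%N | i <- iota 0 (n + n)].
  by rewrite -iotaDl.
rewrite -!map_comp; congr [:: _, _ & _]; rewrite ?expg0 ?mul1g ?expg1 //.
by apply: eq_map => i; rewrite /= add2n expgS expgSr !mulgA.
Qed.

Lemma parity_equiv u v : coxeter_equiv (@cox_mat W) u v -> parity u =1 parity v.
Proof.
elim=> {u v} [//|u v _ IH|u v w _ IHu _ IHv|u v s t] r; first by rewrite IH.
  by rewrite IHu IHv.
have alt1 : wprod (flatten (nseq (cox_mat s t) [:: s; t])) = 1.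
  rewrite -wprod0; apply/cox_pres.
  by have := coxeter_rel (@cox_mat W) [::] [::] s t; rewrite cats0.
rewrite !parity_cat alt1 invg1 mul1g mulg1; congr (_ (+) _).
rewrite /parity refls_alternating iotaD add0n.
have -> : iota (cox_mat s t) (cox_mat s t) =
    [seq (cox_mat s t + i)%N | i <- iota 0 (cox_mat s t)].
  by rewrite -iotaDl addn0.
rewrite map_cat -map_comp count_cat oddD.
set a := map _ _; set b := map _ _; suff -> : b = a by rewrite addbb.
apply: eq_map => i /=; congr (_ * _); rewrite expgnDr -[RHS]mul1g.
congr (_ * _); rewrite -alt1; elim: (cox_mat s t) => [|n IHn] /=.
  by rewrite wprod0.
by rewrite expgS IHn !wprod_cons mulgA.
Qed.

Definition linv w t : bool := parity (sval (cid (cox_surj w))) t.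

Lemma linv_wprod u : linv (wprod u) =1 parity u.
Proof.
move=> t; rewrite /linv; case: cid => v /= /cox_pres vu.
exact: parity_equiv.
Qed.

Lemma linvM x y t : linv (x * y) t = linv x t (+) linv y (x^-1 * t * x).
Proof.
have [[u <-] [v <-]] := (cox_surj x, cox_surj y).
by rewrite -wprod_cat !linv_wprod parity_cat.
Qed.

Lemma linv1 t : linv 1 t = false.
Proof. by rewrite -wprod0 linv_wprod. Qed.

Lemma wprod1 s : wprod [:: s] = cox_emb s.
Proof. by rewrite wprod_cons wprod0 mulg1. Qed.

Lemma linv_emb s t : linv (cox_emb s) t = (t == cox_emb s).
Proof. by rewrite -{1}wprod1 linv_wprod parity_cons addbF. Qed.

Lemma emb_neq1 s : cox_emb s <> 1.
Proof. by move=> E; have := linv_emb s 1; rewrite E linv1 eqxx. Qed.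

Definition is_refl t := exists x s, t = x * cox_emb s * x^-1.

Lemma linv_refl w t : linv w t -> is_refl t.
Proof.
have [u <-] := cox_surj w; rewrite linv_wprod.
elim: u t => [//|s u IHu] t; rewrite parity_cons.
have [->|_ /IHu[x [s' E]]] := eqVneq t (cox_emb s).
  by move=> _; exists 1, s; rewrite mul1g invg1 mulg1.
exists (cox_emb s * x), s'; apply: (can_inj (conj_embK s)).
by rewrite E invgM embV !mulgA embK mul1g -!mulgA embK mulg1.
Qed.

Lemma reflK t : is_refl t -> t * t = 1.
Proof.
by move=> [x [s ->]]; rewrite !mulgA mulgVK -(mulgA x) embK mulg1 mulgV.
Qed.

Lemma refl_conj z t : is_refl t -> is_refl (z * t * z^-1).
Proof. by move=> [x [s ->]]; exists (z * x), s; rewrite invgM !mulgA. Qed.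

Lemma linv_refl_self t : is_refl t -> linv t t.
Proof.
move=> [x [s tE]]; rewrite {1}tE -mulgA !linvM.
have -> : x^-1 * t * x = cox_emb s by rewrite tE !mulgA mulVg mul1g mulgVK.
rewrite linv_emb eqxx embV embK mul1g.
have := linvM x x^-1 t; rewrite mulgV linv1 {2}tE !mulgA mulVg mul1g mulgVK.
by case: (linv x _); case: (linv _ _).
Qed.

Lemma linv_mul_refl t w : is_refl t -> linv (t * w) t = ~~ linv w t.
Proof. by move=> tR; rewrite linvM linv_refl_self // mulVg mul1g. Qed.

Lemma strong_exchange u t (p : pred S) : all p u -> t \in refls u ->
  exists v, [/\ size u = (size v).+1, all p v & wprod v = t * wprod u].
Proof.
elim: u t => [//|s u IHu] t /= /andP[ps pu]; rewrite inE.
have [-> _|_ /=] := eqVneq t (cox_emb s).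
  by exists u; split=> //; rewrite wprod_cons mulgA embK mul1g.
move=> /mapP[r /(IHu _ pu)[v [-> pv vE]] ->].
exists (s :: v); split => //=; first by rewrite ps.
by rewrite !wprod_cons vE !mulgA -(mulgA _ _ (cox_emb s)) embK mulg1.
Qed.

Lemma parity_mem u t : parity u t -> t \in refls u.
Proof. by rewrite /parity; apply: contraLR => /count_memPn ->. Qed.

Lemma parityE u t : uniq (refls u) -> parity u t = (t \in refls u).
Proof. by rewrite /parity => /count_uniq_mem ->; case: (_ \in _). Qed.

Lemma length_le u : (len (wprod u) <= size u)%N.
Proof.
have [|//] := @leastP [set n | exists2 v, size v = n & wprod v = wprod u] (size u).
by exists u.
Qed.

Lemma reduced_ex w : exists2 u, size u = len w & wprod u = w.
Proof.
have [u uw] := cox_surj w.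
have [|//] := @leastP [set n | exists2 v, size v = n & wprod v = w] (size u).
by exists u.
Qed.

Lemma linv_len w t : linv w t -> (len (t * w) < len w)%N.
Proof.
have [u <- <-] := reduced_ex w; rewrite linv_wprod => /parity_mem.
move=> /(strong_exchange (all_predT u))[v [-> _ <-]].
by rewrite ltnS length_le.
Qed.

Lemma linvP w t : is_refl t -> linv w t = (len (t * w) < len w)%N.
Proof.
move=> tR; case: (boolP (linv w t)) => [/linv_len -> //|tw].
have := tw; rewrite -linv_mul_refl // => /linv_len.
by rewrite mulgA reflK // mul1g => /ltnW; rewrite leqNgt => /negbTE.
Qed.

Lemma len_refl_neq w t : is_refl t -> len (t * w) <> len w.
Proof.
move=> tR E; have := linvP (t * w) tR; have := linvP w tR.
rewrite linv_mul_refl // mulgA reflK // mul1g E ltnn => -> //.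
Qed.

Lemma reduced_uniq u : size u = len (wprod u) -> uniq (refls u).
Proof.
elim: u => [//|s u IHu] /= redu.
have lenu : size u = len (wprod u).
  apply/eqP; rewrite eqn_leq length_le andbT.
  have [v vu vE] := reduced_ex (wprod u).
  rewrite -ltnS redu -vu wprod_cons -vE -wprod_cons.
  exact: (leq_trans (length_le _)).
rewrite map_inj_uniq; last exact: can_inj (conj_embK s).
rewrite IHu // andbT; apply/negP => /mapP[r rin E].
have {E} rs : r = cox_emb s.
  by apply: (can_inj (conj_embK s)); rewrite -E embK mul1g.
have [v [vu _ vE]] := strong_exchange (all_predT u) rin.
move: redu; rewrite wprod_cons -rs -vE => E.
by have := length_le v; rewrite -E vu ltnNge leqnSn.
Qed.

Lemma card_linv w : finite_set [set t | linv w t] /\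
  #|` fset_set [set t | linv w t]| = len w.
Proof.
have [u ulen uw] := reduced_ex w.
have uq : uniq (refls u) by apply: reduced_uniq; rewrite ulen uw.
have -> : [set t | linv w t] = [set` [fset t in refls u]%fset].
  apply/seteqP; split => t /=; rewrite -uw linv_wprod parityE // !inE;
  by [|move=> ->].
split; first exact: finite_fset.
rewrite set_fsetK card_fseq.
by rewrite undup_id // size_refls.
Qed.


End CoxeterGroup.

Lemma cardfs_setU (T : choiceType) (A B : set T) : finite_set A -> finite_set B ->
  A `&` B = set0 ->
  #|` fset_set (A `|` B)| = (#|` fset_set A| + #|` fset_set B|)%N.
Proof.
move=> fA fB AB0; rewrite fset_setU // cardfsU -fset_setI // AB0 fset_set0.
by rewrite cardfs0 subn0.
Qed.

Lemma cardfs_image (T U : choiceType) (f : T -> U) (A : set T) : finite_set A ->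
  (forall x y, A x -> A y -> f x = f y -> x = y) ->
  #|` fset_set (f @` A)| = #|` fset_set A|.
Proof.
move=> fA fI; rewrite fset_set_image // card_in_imfset // => x y.
by rewrite !in_fset_set // !inE; apply: fI.
Qed.

Lemma subset_cardfs (T : choiceType) (A B : set T) : finite_set B -> A `<=` B ->
  (#|` fset_set A| <= #|` fset_set B|)%N.
Proof.
move=> fB AB; apply: fsubset_leq_card.
by rewrite -fset_set_sub //; apply: sub_finite_set fB.
Qed.

Lemma finite_max (T : choiceType) (A : set T) (f : T -> nat) (x0 : T) :
  finite_set A -> A x0 -> exists2 x, A x & forall y, A y -> (f y <= f x)%N.
Proof.
move=> fA Ax0; pose P n := `[< exists2 x, A x & f x = n >].
have exP : exists n, P n by exists (f x0); apply/asboolP; exists x0.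
have [|n /asboolP[x Ax <-] xmax] := @ex_maxnP P (\max_(x <- fset_set A) f x) exP.
  move=> n /asboolP[x Ax <-]; apply: (@leq_bigmax_seq _ _ xpredT) => //.
  by rewrite in_fset_set // inE.
by exists x => // y Ay; apply: xmax; apply/asboolP; exists y.
Qed.

(** * Cosets of parabolic subgroups *)

Section CoxeterCosets.
Local Open Scope group_scope.
Variable W : coxeter_system.
Local Notation S := (cox_gen W).
Local Notation wprod := (word_prod (@cox_emb W)).
Local Notation len := (@cox_length W).
Implicit Types (u v : seq S) (s : S) (w x y z t r p c e j k : W) (J K : {set S}).

Lemma len1 : len 1 = 0%N.
Proof. by apply/eqP; rewrite -leqn0 -(wprod0 W) length_le. Qed.

Lemma len_eq0 w : len w = 0%N -> w = 1.
Proof.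
by have [u <- <-] := reduced_ex w => /size0nil ->; rewrite wprod0.
Qed.

Lemma lenV w : len w^-1 = len w.
Proof.
suff le x : (len x^-1 <= len x)%N.
  by apply/eqP; rewrite eqn_leq le -{1}(invgK w) le.
by have [u <- <-] := reduced_ex x; rewrite -wprod_rev -(size_rev u) length_le.
Qed.

Lemma lenM x y : (len (x * y) <= len x + len y)%N.
Proof.
have [u <- <-] := reduced_ex x; have [v <- <-] := reduced_ex y.
by rewrite -wprod_cat -size_cat length_le.
Qed.

Lemma len_emb s : len (cox_emb s) = 1%N.
Proof.
apply/eqP; rewrite eqn_leq -{1}wprod1 (length_le [:: s]) /= lt0n.
by apply/eqP => /len_eq0/emb_neq1.
Qed.

Lemma emb_refl s : is_refl (cox_emb s).
Proof. by exists 1, s; rewrite mul1g invg1 mulg1. Qed.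

Lemma len_embM s w : len (cox_emb s * w) = (len w).+1 \/
  len w = (len (cox_emb s * w)).+1.
Proof.
have /eqP := len_refl_neq (w := w) (emb_refl s).
have := lenM (cox_emb s) w; rewrite len_emb.
have := lenM (cox_emb s) (cox_emb s * w); rewrite mulgA embK mul1g len_emb.
by rewrite !add1n neq_ltn => h1 h2 /orP[h3|h3]; [right|left]; apply/eqP;
  rewrite eqn_leq ?h1 ?h2.
Qed.

Lemma par1 J : parabolic J (1 : W).
Proof. by exists [::] => //; rewrite wprod0. Qed.

Lemma parM J x y : parabolic J x -> parabolic J y -> parabolic J (x * y).
Proof.
move=> [u uJ <-] [v vJ <-]; exists (u ++ v); last by rewrite wprod_cat.
by rewrite all_cat uJ.
Qed.

Lemma parV J x : parabolic J x -> parabolic J x^-1.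
Proof. by move=> [u uJ <-]; exists (rev u); rewrite ?all_rev ?wprod_rev. Qed.

Lemma par_emb J s : s \in J -> parabolic J (cox_emb s).
Proof. by move=> sJ; exists [:: s]; rewrite ?wprod1 //= sJ. Qed.

Lemma par_linv J w t : parabolic J w -> linv w t -> parabolic J t.
Proof.
move=> [u uJ <-]; rewrite linv_wprod.
elim: u t uJ => [//|s u IHu] t /= /andP[sJ uJ]; rewrite parity_cons.
have [-> _|_ /(IHu _ uJ) ct] := eqVneq t (cox_emb s); first exact: par_emb.
rewrite -[t](conj_embK s); apply: parM; last exact: par_emb.
by apply: parM => //; apply: par_emb.
Qed.

Lemma par_reduced J w : parabolic J w ->
  exists u, [/\ all (mem J) u, size u = len w & wprod u = w].
Proof.
move=> [v]; elim: v w => [|s v IHv] w /=.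
  by move=> _ <-; exists [::]; rewrite wprod0 len1.
move=> /andP[sJ /IHv/(_ erefl)[u [uJ ulen uv]]] <-; rewrite wprod_cons -uv.
have [E|E] := len_embM s (wprod u).
  by exists (s :: u); rewrite /= sJ uJ wprod_cons E ulen uv.
have : linv (wprod u) (cox_emb s).
  by rewrite (linvP _ (emb_refl s)) E.
rewrite linv_wprod => /parity_mem/(strong_exchange uJ)[u' [su' u'J u'E]].
by exists u'; split=> //; apply/eqP; rewrite -eqSS -su' ulen -E uv.
Qed.

Definition sep x y t := linv x t (+) linv y t.

Lemma sepE x y t : sep x y t = linv (x^-1 * y) (x^-1 * t * x).
Proof.
rewrite /sep -{1}(mulKg x^-1 y) invgK linvM addbA addbb /=.
by [].
Qed.

Lemma sep_refl x y t : sep x y t -> is_refl t.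
Proof. by rewrite /sep; case: (boolP (linv x t)) => [/linv_refl //|_ /linv_refl]. Qed.

Lemma sepP x y t : is_refl t ->
  sep x y t = (len (x^-1 * t * y) < len (x^-1 * y))%N.
Proof.
move=> tR; rewrite sepE linvP; last by have := refl_conj x^-1 tR; rewrite invgK.
by rewrite !mulgA mulgK.
Qed.

Lemma card_sep x y : finite_set [set t | sep x y t] /\
  #|` fset_set [set t | sep x y t]| = len (x^-1 * y).
Proof.
have [fin card] := card_linv (x^-1 * y).
have -> : [set t | sep x y t] =
    (fun t => x * t * x^-1) @` [set t | linv (x^-1 * y) t].
  apply/seteqP; split => [t|_ [t /= et <-]] /=; rewrite sepE.
    by move=> et; exists (x^-1 * t * x); rewrite ?mulgA ?mulgV ?mul1g ?mulgK.
  by rewrite !mulgA mulVg mul1g mulgVK.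
split; first exact: finite_image.
by rewrite cardfs_image // => r t _ _ /mulIg/mulgI.
Qed.

Definition lcoset J p : set W := [set x | parabolic J (p^-1 * x)].

Lemma lcoset_id J p : lcoset J p p.
Proof. by rewrite /lcoset /= mulVg; apply: par1. Qed.

Lemma lcosetM J p k : parabolic J k -> lcoset J p (p * k).
Proof. by rewrite /lcoset /= mulKg. Qed.

Lemma lcoset2 J p x y : lcoset J p x -> lcoset J p y -> parabolic J (x^-1 * y).
Proof.
move=> /parV xp yp; have := parM xp yp.
by rewrite invgM invgK !mulgA mulgK.
Qed.

Lemma lcoset_eq J p x : lcoset J p x -> lcoset J x = lcoset J p.
Proof.
move=> px; apply/seteqP; split => y; rewrite /lcoset /=; last exact: lcoset2.
by move/(parM px); rewrite !mulgA mulgK.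
Qed.

Lemma sep_par J p x y t : lcoset J p x -> lcoset J p y -> sep x y t ->
  parabolic J (p^-1 * t * p).
Proof.
move=> px py; rewrite sepE => /(par_linv (lcoset2 px py)) h.
have := parM (parM px h) (parV px).
by rewrite invgM invgK !mulgA !mulgK.
Qed.

Lemma sep_stable J p x y t z : lcoset J p x -> lcoset J p y -> sep x y t ->
  lcoset J p z -> lcoset J p (t * z).
Proof.
move=> px py /(sep_par px py) h pz; have := parM h pz.
by rewrite /lcoset /= !mulgA mulgK.
Qed.

(** [p] is the projection of [c] to its [K]-residue iff [perp K (c^-1 * p)]. *)
Definition perp K w := forall k, parabolic K k -> (len w <= len (w * k))%N.

Lemma perp_linv K w r : perp K w -> parabolic K r -> linv w (w * r * w^-1) = false.
Proof.
move=> pw Kr; apply/negP => /linv_len; rewrite mulgVK ltnNge => /negP; apply.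
exact: pw.
Qed.

Lemma linv_perp_len K w k :
  (forall r, parabolic K r -> linv w (w * r * w^-1) = false) ->
  parabolic K k -> len (w * k) = (len w + len k)%N.
Proof.
move=> pw Kk; have [fwk <-] := card_linv (w * k).
have [fw <-] := card_linv w; have [fk <-] := card_linv k.
rewrite -(@cardfs_image _ _ (fun r => w * r * w^-1) [set r | linv k r]) //; last first.
  by move=> r t _ _ /mulIg/mulgI.
have disj t : linv k (w^-1 * t * w) -> linv w t = false.
  move=> /(par_linv Kk)/pw.
  by rewrite !mulgA mulgV mul1g mulgK.
rewrite -cardfs_setU //; first 1 last.
- exact: finite_image.
- apply/eqP/negP => /negP/set0P[t [/= wt [r kr E]]]; move: wt; rewrite -E pw //.
  exact: par_linv kr.
congr #|` fset_set _|; apply/seteqP; split => t /=.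
  rewrite linvM; have [h|h] := boolP (linv k (w^-1 * t * w)); last first.
    by rewrite addbF; left.
  move=> _; right; exists (w^-1 * t * w) => //.
  by rewrite !mulgA mulgV mul1g mulgK.
move=> [wt|[r kr <-]]; rewrite linvM.
  by have [/disj|] := boolP (linv k (w^-1 * t * w)); rewrite ?wt.
by rewrite !mulgA mulVg mul1g mulgVK kr pw //; apply: par_linv kr.
Qed.

Lemma perp_len K w k : perp K w -> parabolic K k -> len (w * k) = (len w + len k)%N.
Proof. by move=> pw; apply: linv_perp_len => r; apply: perp_linv. Qed.

Lemma linv_perp K w :
  (forall r, parabolic K r -> linv w (w * r * w^-1) = false) -> perp K w.
Proof. by move=> pw k Kk; rewrite (linv_perp_len pw) // leq_addr. Qed.

Lemma perp_inj K w k : perp K w -> perp K (w * k) -> parabolic K k -> k = 1.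
Proof.
move=> pw pwk Kk; apply: len_eq0; have := pwk k^-1 (parV Kk).
rewrite mulgK (perp_len pw) // -[leqRHS]addn0 leq_add2l leqn0.
by move/eqP.
Qed.

Lemma gate_ex K x p : exists2 e, lcoset K p e & perp K (x^-1 * e).
Proof.
have [|[e pe eE] emin] := @leastP
    [set n | exists2 e, lcoset K p e & len (x^-1 * e) = n] (len (x^-1 * p)).
  by exists p => //; apply: lcoset_id.
exists e => // k Kk; rewrite eE -mulgA.
have [|_] := @leastP [set n | exists2 e, lcoset K p e & len (x^-1 * e) = n]
    (len (x^-1 * (e * k))); last by [].
exists (e * k) => //; rewrite /lcoset /= mulgA; exact: parM.
Qed.

Lemma gate_sep K x p y z t : perp K (x^-1 * p) -> lcoset K p y -> lcoset K p z ->
  sep y z t -> sep x p t = false.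
Proof.
move=> pp py pz /(sep_par py pz)/(perp_linv pp); rewrite sepE invgM invgK.
by rewrite !mulgA !mulgK.
Qed.

Lemma kilmoyer J K w (v : W) : perp K w -> parabolic K v ->
  parabolic J (w * v * w^-1) ->
  parabolic [set k in K | `[< parabolic J (w * cox_emb k * w^-1) >]]%SET v.
Proof.
move=> pw; have [n] := ubnP (len v); elim: n v => // n IHn v.
rewrite ltnS => lev Kv Jv; have [u [uK ulen uv]] := par_reduced Kv.
case: u uK ulen uv => [_ _ <-|k u /= /andP[kK uK] ulen uv].
  by rewrite wprod0; apply: par1.
have v'E : cox_emb k * v = wprod u by rewrite -uv wprod_cons mulgA embK mul1g.
have lenv' : (len (wprod u) < len v)%N by rewrite -ulen ltnS length_le.
have Jk : parabolic J (w * cox_emb k * w^-1).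
  apply: (@par_linv J (w * v * w^-1)) => //.
  have := linvM (w * v * w^-1) w (w * cox_emb k * w^-1).
  rewrite mulgVK linvM (perp_linv pw (par_emb kK)).
  have -> : w^-1 * (w * cox_emb k * w^-1) * w = cox_emb k.
    by rewrite !mulgA mulVg mul1g mulgVK.
  have -> : (w * v * w^-1)^-1 * (w * cox_emb k * w^-1) * (w * v * w^-1) =
      w * (v^-1 * cox_emb k * v) * w^-1.
    by rewrite !invgM invgK !mulgA !mulgVK.
  rewrite (linvP _ (emb_refl k)) v'E lenv' (perp_linv pw) ?addbF; first by move=> <-.
  by apply: parM => //; apply: parM; [exact: parV|exact: par_emb].
rewrite -uv wprod_cons; apply: parM.
  by apply: par_emb; rewrite inE kK; apply/asboolP.
apply: IHn; first exact: leq_trans lev.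
  by exists u.
rewrite -v'E; have := parM Jk Jv.
by rewrite !mulgA mulgVK.
Qed.

Lemma perp_lcoset J K w c : perp K w -> parabolic J c ->
  exists j, [/\ parabolic J j, lcoset K w (j * w) & perp K (c^-1 * (j * w))].
Proof.
move=> pw [u]; elim/last_ind: u c => [|u s IHu] c.
  move=> _ <-; exists 1; rewrite wprod0 invg1 !mul1g.
  by split=> //; [exact: par1|exact: lcoset_id].
rewrite all_rcons => /andP[sJ uJ] <-.
have [j [Jj wj pj]] := IHu _ uJ erefl; rewrite -cats1 wprod_cat wprod1.
set c' := wprod u in pj *; set t := c' * cox_emb s * c'^-1.
have Jt : parabolic J t.
  by apply: parM; [apply: parM; [exists u|exact: par_emb]|apply: parV; exists u].
have [cut|ncut] := pselect (parabolic K ((j * w)^-1 * t * (j * w))).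
  exists (t * j); split; first exact: parM.
    have := parM wj cut; rewrite /lcoset /= invgM !mulgA.
    by rewrite mulgK mulgK.
  by rewrite invgM /t embV !mulgA mulgVK embK mul1g -mulgA.
exists j; split=> //; apply: linv_perp => r Kr.
set x := c'^-1 * (j * w) in pj.
have -> : (c' * cox_emb s)^-1 * (j * w) = cox_emb s * x.
  by rewrite /x invgM embV !mulgA.
have -> : cox_emb s * x * r * (cox_emb s * x)^-1 =
    cox_emb s * (x * r * x^-1) * cox_emb s by rewrite invgM embV !mulgA.
rewrite linvM embV linv_emb conj_embK (perp_linv pj Kr) addbF.
apply/eqP => E; apply: ncut.
suff <- : r = (j * w)^-1 * t * (j * w) by [].
have {}E : x * r * x^-1 = cox_emb s.
  by apply: (can_inj (conj_embK s)); rewrite embK mul1g.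
have -> : r = x^-1 * (x * r * x^-1) * x by rewrite -[RHS]mulgA mulgVK mulKg.
by rewrite E /t /x invgM invgK !mulgA.
Qed.

Lemma perp_double_coset J K w j k : perp K w -> parabolic J j -> parabolic K k ->
  perp K (j * w * k) -> exists2 j', parabolic J j' & j * w * k = j' * w.
Proof.
move=> pw Jj Kk pu; have [j1 [Jj1 wj1]] := perp_lcoset pw (parV Jj).
rewrite invgK => pj; exists (j * j1); first exact: parM.
have wk := lcosetM w Kk.
have Kk' := lcoset2 wj1 wk.
have E : j * w * k = j * (j1 * w) * ((j1 * w)^-1 * (w * k)).
  by rewrite -(mulgA j (j1 * w)) mulVKg mulgA.
rewrite E in pu *; rewrite (perp_inj pj pu Kk') mulg1.
by rewrite !mulgA.
Qed.

(** In an apartment identified with [W], the roots containing [R1] but not [R2]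
    correspond to [walls_off R1 R2]: a root missing [R2] is determined by its
    wall. *)
Definition walls_off (A B : set W) : set W :=
  [set t | exists2 c, A c & forall e, B e -> sep c e t].

Lemma opposite_ex J c : finite_set (@parabolic W J) ->
  exists2 c', lcoset J c c' &
    forall y z t, lcoset J c y -> lcoset J c z -> sep y z t -> sep c c' t.
Proof.
move=> fJ.
have fc : finite_set (lcoset J c).
  apply: sub_finite_set (finite_image (fun k => c * k) fJ) => x cx.
  by exists (c^-1 * x); rewrite ?mulVKg.
have [c' cc' max] := finite_max (fun x => len (c^-1 * x)) fc (lcoset_id J c).
exists c' => // y z t cy cz /[dup] yzt /sep_refl tR.
apply/negPn/negP; rewrite sepP // -leqNgt leq_eqVlt => /orP[/eqP E|].
  have := len_refl_neq (w := c^-1 * c') (refl_conj c^-1 tR).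
  by rewrite invgK !mulgA mulgK => /(_ (esym E)).
by rewrite ltnNge -mulgA max //; apply: sep_stable yzt _.
Qed.

Lemma sep_walls_off K A b c p : A c -> lcoset K b p -> perp K (c^-1 * p) ->
  [set t | sep c p t] `<=` walls_off A (lcoset K b).
Proof.
move=> Ac bp pp t /= cpt; exists c => // e be.
have pe : lcoset K p e by rewrite (lcoset_eq bp).
have npe : sep p e t = false.
  by apply/negP => /(gate_sep pp (lcoset_id K p) pe); rewrite cpt.
move: cpt npe; rewrite /sep.
by case: (linv c t); case: (linv p t); case: (linv e t).
Qed.

Lemma walls_off_hausdorff J K a b : finite_set (@parabolic W J) ->
  let A := lcoset J a in let B := lcoset K b in
  [/\ finite_set (walls_off A B),
    exists2 c, A c & forall e, B e ->
      (#|` fset_set (walls_off A B)| <= len (c^-1 * e))%N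
  & forall c, A c -> exists2 e, B e &
      (len (c^-1 * e) <= #|` fset_set (walls_off A B)|)%N].
Proof.
move=> fJ A B.
have [c0 ac0 pc0] := gate_ex J b a.
have [c1 c01 opp] := opposite_ex c0 fJ.
have ac1 : A c1 by rewrite /A -(lcoset_eq ac0).
have [p bp pp] := gate_ex K c1 b.
have E : walls_off A B = [set t | sep c1 p t].
  apply/seteqP; split; last exact: sep_walls_off.
  move=> t [c ac h].
  have bbt : sep b p t = false.
    have := h b (lcoset_id K b); have := h p bp.
    by rewrite /sep; case: (linv c t); case: (linv b t); case: (linv p t).
  have [cc1|] := boolP (sep c c1 t); last first.
    have := h p bp; rewrite /sep /=.
    by case: (linv c t); case: (linv c1 t); case: (linv p t).
  have cc0 : lcoset J c0 c by rewrite (lcoset_eq ac0).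
  have := opp _ _ _ cc0 c01 cc1.
  have := gate_sep pc0 cc0 c01 cc1.
  move: bbt; rewrite /sep /=.
  by case: (linv b t); case: (linv c0 t); case: (linv c1 t); case: (linv p t).
have [fs card] := card_sep c1 p.
split; first by rewrite E.
  exists c1 => // e be; rewrite E card.
  have := pp (p^-1 * e) (lcoset2 bp be).
  by rewrite mulgA mulgK.
move=> c ac; have [e be pe] := gate_ex K c b; exists e => //.
rewrite -(card_sep c e).2; apply: subset_cardfs; first by rewrite E.
exact: sep_walls_off.
Qed.

Section Projection.
Variables (K : {set S}) (q0 : W) (A B : set W).
Let E := lcoset K q0.
Hypotheses (A0 : A !=set0) (BE : B `<=` E) (B0 : B !=set0).

Definition coset_proj : set W :=
  [set p | exists2 c, A c & E p /\ perp K (c^-1 * p)].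
Let P := coset_proj.

Let cut : set W := [set t | exists y z, [/\ E y, E z & sep y z t]].

Let gateP c : A c -> exists p, [/\ P p, E p & forall t, cut t -> sep c p t = false].
Proof.
move=> Ac; have [p Ep pp] := gate_ex K c q0; exists p; split=> //; first by exists c.
move=> t [y [z [Ey Ez]]].
by apply: (gate_sep pp (y := y) (z := z)); rewrite (lcoset_eq Ep).
Qed.

Let P_gate p : P p -> exists c, [/\ A c, E p & forall t, cut t -> sep c p t = false].
Proof.
move=> [c Ac [Ep pp]]; exists c; split => // t [y [z [Ey Ez]]].
by apply: (gate_sep pp (y := y) (z := z)); rewrite (lcoset_eq Ep).
Qed.

Lemma card_walls_off_from : finite_set (walls_off A B) ->
  #|` fset_set (walls_off A B)| =
    (#|` fset_set (walls_off A E)| + #|` fset_set (walls_off P B)|)%N.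
Proof.
move=> fAB; have [q1 Bq1] := B0.
have U : walls_off A B = walls_off A E `|` walls_off P B.
  apply/seteqP; split => [t [c Ac h]|t [[c Ac h]|[p Pp h]]].
  - have [tcut|ncut] := pselect (cut t).
      right; have [p [Pp Ep /(_ _ tcut) cp]] := gateP Ac; exists p => // e Be.
      have := h e Be; move: cp; rewrite /sep.
      by case: (linv c t); case: (linv p t).
    left; exists c => // e Ee; apply/negP => /negP nce; apply: ncut.
    exists q1, e; split=> //; first exact: BE.
    have := h _ Bq1; move: nce; rewrite /sep.
    by case: (linv c t); case: (linv q1 t); case: (linv e t).
  - by exists c => // e /BE; apply: h.
  - have [c [Ac Ep cp]] := P_gate Pp.
    have tcut : cut t by exists p, q1; split=> //; [exact: BE|exact: h].
    exists c => // e Be; have := h e Be; have := cp t tcut; rewrite /sep.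
    by case: (linv c t); case: (linv p t).
rewrite U in fAB *; move: fAB; rewrite finite_setU => -[f1 f2].
rewrite cardfs_setU //; apply/eqP/negP => /negP/set0P[t [[c Ac h] [p Pp h']]].
have [_ [_ Ep _]] := P_gate Pp.
have := h' _ Bq1; have := h _ Ep; have := h _ (BE Bq1); rewrite /sep.
by case: (linv c t); case: (linv q1 t); case: (linv p t).
Qed.

Let walls_off_cut (B' : set W) : B' `<=` E ->
  walls_off B' A `&` cut = walls_off B' P.
Proof.
move=> B'E; apply/seteqP; split => [t [[q Bq h] tcut]|t [q Bq h]].
  exists q => // p /P_gate[c [Ac _ /(_ _ tcut) cp]].
  have := h c Ac; move: cp; rewrite /sep.
  by case: (linv c t); case: (linv p t).
have [a Aa] := A0; have [p [Pp Ep _]] := gateP Aa.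
have tcut : cut t by exists q, p; split=> //; [exact: B'E|exact: h].
split=> //; exists q => // c /gateP[p' [Pp' _ /(_ _ tcut) cp]].
have := h p' Pp'; move: cp; rewrite /sep.
by case: (linv c t); case: (linv p' t).
Qed.

Let walls_off_uncut : walls_off B A `\` cut = walls_off E A `\` cut.
Proof.
apply/seteqP; split => t [[q Bq h] ncut]; split => //.
  by exists q => //; apply: BE.
have [q1 Bq1] := B0; exists q1 => // c Ac.
have n2 := h c Ac; apply/negPn/negP => n1; apply: ncut.
exists q, q1; split=> //; first exact: BE.
by move: n1 n2; rewrite /sep; case: (linv c t); case: (linv q t); case: (linv q1 t).
Qed.

Lemma card_walls_off_to :
  finite_set (walls_off B A) -> finite_set (walls_off E A) ->
  (#|` fset_set (walls_off B A)| + #|` fset_set (walls_off E P)|)%N =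
  (#|` fset_set (walls_off E A)| + #|` fset_set (walls_off B P)|)%N.
Proof.
move=> fBA fEA.
have split_cut D : finite_set D -> #|` fset_set D| =
    (#|` fset_set (D `&` cut)| + #|` fset_set (D `\` cut)|)%N.
  move=> fD; rewrite -cardfs_setU //; first by rewrite setDE -setIUr setUv setIT.
  - exact: finite_setIl.
  - exact: finite_setD.
  - by rewrite setDE setIACA setICr setI0.
rewrite (split_cut _ fBA) (split_cut _ fEA) !walls_off_cut // walls_off_uncut.
by rewrite addnAC addnC addnA [RHS]addnAC addnC addnCA addnC -addnA.
Qed.

End Projection.
End CoxeterCosets.

(** * Weyl distance and projections *)

Section WeylDistance.
Local Open Scope group_scope.
Variables (W : coxeter_system) (X : building W).
Local Notation S := (cox_gen W).
Local Notation wprod := (word_prod (@cox_emb W)).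
Local Notation len := (@cox_length W).
Implicit Types (u v : seq S) (s : S) (w x y z : W) (J K : {set S}).
Implicit Types (a b c d e p q : X).

Lemma wdistxx c : wdist c c = 1.
Proof. exact/wdist1. Qed.

Lemma wdist_step c d : wdist c d <> 1 ->
  exists s c', [/\ wdist c' c = cox_emb s, wdist c d = cox_emb s * wdist c' d &
    len (wdist c d) = (len (wdist c' d)).+1].
Proof.
have [[|s u] ulen uw] := reduced_ex (wdist c d); first by rewrite -uw wprod0.
move=> _; have [c' c'c c'd] := wdistE c d s; exists s, c'.
have c'E : wdist c' d = wprod u by rewrite c'd -uw wprod_cons mulgA embK mul1g.
rewrite c'E -{1}uw wprod_cons; split=> //.
have [<-|h] := len_embM s (wprod u); first by rewrite -wprod_cons uw.
have := length_le u; rewrite h -wprod_cons uw -ulen /=.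
by rewrite leqNgt ltnS leqnSn.
Qed.

Lemma wdist_ind (P : X -> X -> Prop) : (forall c, P c c) ->
  (forall s c c' d, wdist c' c = cox_emb s ->
     wdist c d = cox_emb s * wdist c' d ->
     len (wdist c d) = (len (wdist c' d)).+1 -> P c' d -> P c d) ->
  forall c d, P c d.
Proof.
move=> P0 PS c d; have [n] := ubnP (len (wdist c d)); elim: n c => // n IHn c.
rewrite ltnS => le; have [/wdist1 -> //|/wdist_step] := pselect (wdist c d = 1).
move=> [s [c' [c'c E l]]]; apply: (PS s c c') => //; apply: IHn.
by rewrite -l.
Qed.

Lemma wdist_emb_sym c d s : wdist c d = cox_emb s -> wdist d c = cox_emb s.
Proof.
move=> cd; have := wdistW c cd; rewrite wdistxx => -[] h.
  have := mulg1_eq (esym h); rewrite embV => /esym; exact.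
by move: cd; have /wdist1 -> := esym h; rewrite wdistxx => /esym/emb_neq1.
Qed.

Lemma wdistM c d e :
  len (wdist c d * wdist d e) = (len (wdist c d) + len (wdist d e))%N ->
  wdist c e = wdist c d * wdist d e.
Proof.
move: c d; apply: wdist_ind => [c|s c c' d c'c E l IH].
  by rewrite wdistxx mul1g.
rewrite l E -mulgA addSn => h.
have h' : len (wdist c' d * wdist d e) = (len (wdist c' d) + len (wdist d e))%N.
  apply/eqP; rewrite eqn_leq lenM -ltnS -h.
  by apply: leq_trans (lenM _ _) _; rewrite len_emb add1n.
rewrite -(IH h'); apply: (wdistL (wdist_emb_sym c'c)).
by rewrite (IH h') h h'.
Qed.

Lemma wdistV c d : wdist d c = (wdist c d)^-1.
Proof.
move: c d; apply: wdist_ind => [c|s c c' d c'c E l IH].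
  by rewrite wdistxx invg1.
have M : wdist d c' * wdist c' c = (wdist c d)^-1 by rewrite IH c'c E invgM embV.
rewrite -M; apply: wdistM; rewrite M lenV l IH lenV c'c len_emb.
by rewrite addn1.
Qed.

Lemma wdistW_right c d d' s : wdist d' d = cox_emb s ->
  wdist c d' = wdist c d * cox_emb s \/ wdist c d' = wdist c d.
Proof.
move=> d'd; rewrite !(wdistV _ c).
by have [->|->] := wdistW c d'd; [left; rewrite invgM embV|right].
Qed.

Lemma len_wdist_triangle c d e :
  (len (wdist c e) <= len (wdist c d) + len (wdist d e))%N.
Proof.
move: c d; apply: wdist_ind => [c|s c c' d c'c E l IH].
  by rewrite wdistxx len1.
rewrite l addSn; have [->|->] := wdistW e (wdist_emb_sym c'c).
  by apply: leq_trans (lenM _ _) _; rewrite len_emb add1n ltnS.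
exact: leqW.
Qed.

Lemma gallery_distE c d : gallery_dist c d = len (wdist c d).
Proof.
have lower (q : seq X) : path (fun a b : X => `[< adjacent a b >]) c q ->
    (len (wdist c (last c q)) <= size q)%N.
  elim: q {d} c => [|a q IHq] c /=; first by rewrite wdistxx len1.
  move=> /andP[/asboolP[s ca] /IHq le].
  by apply: leq_trans (len_wdist_triangle _ a _) _; rewrite ca len_emb add1n ltnS.
have upper : exists q : seq X, [/\ size q = len (wdist c d),
    path (fun a b : X => `[< adjacent a b >]) c q & last c q = d].
  move: c d {lower}; apply: wdist_ind => [c|s c c' d c'c E l [q [qs qp ql]]].
    by exists [::]; rewrite wdistxx len1.
  exists (c' :: q); rewrite /= qs l qp ql andbT; split=> //.
  by apply/asboolP; exists s; apply: wdist_emb_sym.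
have [[q [qs qp ql]] le] := @leastP [set n | exists p : seq X,
  [/\ size p = n, path (fun a b : X => `[< adjacent a b >]) c p
    & last c p = d]] _ upper.
apply/eqP; rewrite eqn_leq le /=.
by rewrite /gallery_dist -qs -[in wdist c d]ql lower.
Qed.

Lemma wdist_left_ex J j c d : parabolic J j ->
  exists2 c', parabolic J (wdist c c') & wdist c' d = j * wdist c d.
Proof.
move=> [u uJ <-]; elim: u uJ => [_|s u IHu] /=.
  by exists c; rewrite ?wdistxx ?wprod0 ?mul1g //; exact: par1.
move=> /andP[sJ /IHu[c' Jc' c'd]].
have [e ec' ed] := wdistE c' d s; exists e; last by rewrite ed c'd wprod_cons mulgA.
have [->|-> //] := wdistW_right c ec'.
by apply: parM => //; exact: par_emb.
Qed.

Lemma wdist_right_ex J j c d : parabolic J j ->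
  exists2 d', parabolic J (wdist d d') & wdist c d' = wdist c d * j.
Proof.
move=> /parV/(wdist_left_ex d c)[d' Jd' d'c]; exists d' => //.
by rewrite wdistV d'c invgM invgK -wdistV.
Qed.

Lemma wdist_right c b d K : parabolic K (wdist b d) ->
  exists2 k, parabolic K k & wdist c d = wdist c b * k.
Proof.
move=> [u]; elim: u b => [|s u IHu] b /=.
  by rewrite wprod0 => _ /esym/wdist1 ->; exists 1; rewrite ?mulg1 //; exact: par1.
move=> /andP[sK uK] E; have [b' b'b b'd] := wdistE b d s.
have [|k Kk ->] := IHu b' uK; first by rewrite b'd -E wprod_cons mulgA embK mul1g.
have [->|->] := wdistW_right c b'b; last by exists k.
by exists (cox_emb s * k); rewrite ?mulgA //; apply: parM => //; apply: par_emb.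
Qed.

Lemma wdist_left c b d J : parabolic J (wdist c b) ->
  exists2 j, parabolic J j & wdist c d = j * wdist b d.
Proof.
rewrite wdistV => Jcb; have [|k Jk E] := @wdist_right d b c J.
  by rewrite -[wdist b c]invgK; exact: parV.
by exists k^-1; [exact: parV|rewrite wdistV E invgM -wdistV].
Qed.

Lemma residue_of_id J c : residue_of J c c.
Proof. by rewrite /residue_of /= wdistxx; exact: par1. Qed.

Lemma residue_of2 J c d e :
  residue_of J c d -> residue_of J c e -> parabolic J (wdist d e).
Proof.
move=> cd /(wdist_right d)[k Jk ->]; apply: parM => //.
by rewrite wdistV; exact: parV.
Qed.

Lemma residue_of_eq J c d : residue_of J c d -> residue_of J d = residue_of J c.
Proof.
move=> cd; apply/seteqP; split => e; last exact: residue_of2.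
by move=> /(wdist_right c)[k Jk E]; rewrite /residue_of /= E; apply: parM.
Qed.

Lemma wdist_perp K c p e : perp K (wdist c p) -> parabolic K (wdist p e) ->
  wdist c e = wdist c p * wdist p e.
Proof. by move=> pp Kpe; apply: wdistM; apply: perp_len Kpe. Qed.

Lemma gallery_dist_perp K c p e :
  perp K (wdist c p) -> parabolic K (wdist p e) ->
  gallery_dist c e = (gallery_dist c p + gallery_dist p e)%N.
Proof. by move=> pp Kpe; rewrite !gallery_distE (wdist_perp pp) // (perp_len pp). Qed.

Lemma gallery_dist_triangle c d e :
  (gallery_dist c e <= gallery_dist c d + gallery_dist d e)%N.
Proof. by rewrite !gallery_distE len_wdist_triangle. Qed.

Lemma gallery_distC c d : gallery_dist c d = gallery_dist d c.
Proof. by rewrite !gallery_distE wdistV lenV. Qed.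

Lemma gallery_dist0 c d : gallery_dist c d = 0%N -> c = d.
Proof. by rewrite gallery_distE => /len_eq0/wdist1. Qed.

Lemma gallery_distxx c : gallery_dist c c = 0%N.
Proof. by rewrite gallery_distE wdistxx len1. Qed.

Section Gates.
Variables (sigma : @residue W X) (K : {set S}) (b : X).
Hypothesis sigmaE : val sigma = residue_of K b.

Lemma nearestP c p : nearest sigma c p <-> residue_of K b p /\ perp K (wdist c p).
Proof.
rewrite /nearest /= sigmaE; split => -[bp h]; split=> //.
  move=> k /(wdist_right_ex c p)[p' pp' E]; rewrite -E -!gallery_distE.
  by apply: h; rewrite -(residue_of_eq bp).
move=> e be; rewrite (gallery_dist_perp h (residue_of2 bp be)).
exact: leq_addr.
Qed.

Lemma nearest_ex c : exists p, nearest sigma c p.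
Proof.
have [|[p bp pE] pmin] := @leastP
    [set n | exists2 p, residue_of K b p & gallery_dist c p = n] (gallery_dist c b).
  by exists b => //; apply: residue_of_id.
exists p; split; rewrite sigmaE // => e be; rewrite pE.
by have [|] := @leastP
  [set n | exists2 p, residue_of K b p & gallery_dist c p = n] (gallery_dist c e);
  first by exists e.
Qed.

Lemma nearest_dist c p e : nearest sigma c p -> val sigma e ->
  gallery_dist c e = (gallery_dist c p + gallery_dist p e)%N.
Proof.
move=> /nearestP[bp pp]; rewrite sigmaE => be.
exact: gallery_dist_perp pp (residue_of2 bp be).
Qed.

Definition proj_set (A : set X) : set X :=
  [set d | exists2 c, A c & nearest sigma c d].

Lemma proj_set_residue_of J a : exists (I : {set S}) p,
  [/\ I \subset K, residue_of K b p & proj_set (residue_of J a) = residue_of I p].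
Proof.
pose D := [set n | exists c p,
  [/\ residue_of J a c, residue_of K b p & gallery_dist c p = n]].
have D0 : D (gallery_dist a b) by exists a, b; split=> //; exact: residue_of_id.
have [[c0 [p0 [ac0 bp0 w0]]] _] := leastP D0.
have wmin c p : residue_of J a c -> residue_of K b p ->
    (gallery_dist c0 p0 <= gallery_dist c p)%N.
  move=> ac bp; rewrite w0.
  by have [] := @leastP D (gallery_dist c p); first by exists c, p.
set w := wdist c0 p0.
have /nearestP[_ pw] : nearest sigma c0 p0.
  by split; rewrite sigmaE // => e; apply: wmin.
pose I := [set k in K | `[< parabolic J (w * cox_emb k * w^-1) >]]%SET.
exists I, p0; split=> //.
  by apply/fintype.subsetP => k; rewrite inE => /andP[].
apply/seteqP; split => [p [c ac /nearestP[bp pp]]|p Ip].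
  have Kp := residue_of2 bp0 bp.
  have [j1 Jj1 E1] := wdist_left p0 (residue_of2 ac ac0).
  have [k1 Kk1 E2] := wdist_right c Kp.
  rewrite E2 E1 in pp; have [j2 Jj2 E3] := perp_double_coset pw Jj1 Kk1 pp.
  have [j3 Jj3 E4] := wdist_left p (residue_of2 ac0 ac).
  apply: (kilmoyer pw Kp); rewrite -(wdist_perp pw Kp) E4 E2 E1 E3 !mulgA mulgK.
  exact: parM.
have [Kp Jp] : parabolic K (wdist p0 p) /\ parabolic J (w * wdist p0 p * w^-1).
  case: Ip => u uI <-; split.
    by exists u => //; apply: sub_all uI => k /=; rewrite inE => /andP[].
  elim: u uI => [|k u IHu] /=; first by rewrite wprod0 mulg1 mulgV => _; exact: par1.
  rewrite inE => /andP[/andP[_ /asboolP Jk] /IHu Ju].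
  by have := parM Jk Ju; rewrite wprod_cons !mulgA mulgVK.
have [c c0c E] := wdist_left_ex c0 p (parV Jp).
have ac : residue_of J a c by rewrite -(residue_of_eq ac0).
exists c => //; have cpw : wdist c p = w.
  have cancel_conj y k : (y * k * y^-1)^-1 * (y * k) = y.
    by rewrite !invgM invgK !mulgA !mulgVK.
  by rewrite E (wdist_perp pw Kp) cancel_conj.
split; first by rewrite sigmaE -(residue_of_eq bp0).
rewrite sigmaE => e be; rewrite [X in (X <= _)%N]gallery_distE cpw -gallery_distE.
exact: wmin.
Qed.

End Gates.

Lemma proj_val (sigma : @residue W X) (A : set X) : A \in @residue W X ->
  val (val (Defs.proj sigma A)) = proj_set sigma A.
Proof.
move=> /set_mem[J [a ->]]; have /set_mem[K [b sE]] := valP sigma.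
have [I [p [IK bp E]]] := proj_set_residue_of sE J a.
rewrite /Defs.proj; apply: (@xgetPex _ (star_self sigma)
  [set P | val (val P) = proj_set sigma (residue_of J a)]).
have resP : proj_set sigma (residue_of J a) \in @residue W X.
  by apply/mem_set; exists I, p.
have subP : (SigSub resP : @residue W X) \in star sigma.
  by apply/mem_set => d /= [c _ []].
by exists (SigSub subP).
Qed.

End WeylDistance.

(** * Apartments and the root-distance *)

Section Apartments.
Local Open Scope group_scope.
Variables (W : coxeter_system) (X : building W).
Local Notation S := (cox_gen W).
Local Notation wprod := (word_prod (@cox_emb W)).
Local Notation len := (@cox_length W).
Implicit Types (u v : seq S) (s : S) (w x y z : W) (J K : {set S}).
Implicit Types (a b c d e p q : X).

Lemma len_wdist_sub a b c :
  (len ((wdist a b)^-1 * wdist a c) <= len (wdist b c))%N.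
Proof.
move: b c; apply: wdist_ind => [b|s b b' c b'b E l IH]; first by rewrite mulVg len1.
have [h|h] := wdistW_right a b'b; rewrite l; last by rewrite -h leqW.
move: IH; rewrite h invgM embV -mulgA => IH.
have := lenM (cox_emb s) (cox_emb s * ((wdist a b)^-1 * wdist a c)).
rewrite mulgA embK mul1g len_emb add1n => le; apply: leq_trans le _.
by rewrite ltnS.
Qed.

(** As [wdist a b1] and [wdist a b2] lie on the same side of the wall of [s], so
    does a minimal gallery joining them; hence the projection to the [s]-panel
    of [a] is constant along a minimal gallery from [b1] to [b2]. *)
Lemma wdist_fold s a e b1 b2 : wdist e a = cox_emb s ->
  wdist b1 b2 = (wdist a b1)^-1 * wdist a b2 ->
  linv (wdist a b1) (cox_emb s) -> linv (wdist a b2) (cox_emb s) ->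
  wdist e b1 = cox_emb s * wdist a b1 -> wdist e b2 = cox_emb s * wdist a b2.
Proof.
move=> ea; move: b1 b2; apply: wdist_ind => [//|s1 b1 b' b2 b'b1 E l IH].
move=> E12 e1 e2 eb1.
have bb' : wdist a b' = wdist a b1 * cox_emb s1.
  have [//|h] := wdistW_right a b'b1.
  by have := len_wdist_sub a b' b2; rewrite h -E12 l ltnn.
have neq : cox_emb s * wdist a b1 <> wdist a b1 * cox_emb s1.
  move=> h; have : sep (wdist a b1) (wdist a b2) (cox_emb s).
    rewrite sepE -E12 -mulgA h mulKg linvP; last exact: emb_refl.
    by rewrite E mulgA embK mul1g -E l.
  by rewrite /sep e1 e2.
have e' : linv (wdist a b') (cox_emb s).
  rewrite bb' linvM e1 linv_emb /=; apply/negP => /eqP h; apply: neq.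
  by rewrite -h !mulgA mulgV mul1g.
apply: IH => //.
  by rewrite bb' invgM embV -mulgA -E12 E mulgA embK mul1g.
have [->|h] := wdistW b' ea; first by [].
have [h'|h'] := wdistW_right e b'b1; first by rewrite h' eb1 bb' mulgA.
by case: neq; rewrite -eb1 -h' h bb'.
Qed.

Definition isometric (G : set (W * X)) : Prop :=
  forall g h, G g -> G h -> wdist g.2 h.2 = g.1^-1 * h.1.

Lemma isometric_extend (G : set (W * X)) x a s : isometric G -> G (x, a) ->
  exists e, forall g, G g -> wdist e g.2 = (x * cox_emb s)^-1 * g.1.
Proof.
move=> iG Ga.
have aE g : G g -> wdist a g.2 = x^-1 * g.1 by move=> /(iG _ _ Ga).
have [e [ea eE]] : exists e, wdist e a = cox_emb s /\
    forall g, G g -> linv (wdist a g.2) (cox_emb s) ->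
      wdist e g.2 = cox_emb s * wdist a g.2.
  have [[g0 [Gg0 eg0]]|none] :=
      pselect (exists g, G g /\ linv (wdist a g.2) (cox_emb s)).
    have [e ea eg] := wdistE a g0.2 s; exists e; split=> // g Gg etag.
    apply: (wdist_fold ea _ eg0 etag eg).
    by rewrite (iG _ _ Gg0 Gg) (aE _ Gg0) (aE _ Gg) invgM invgK !mulgA mulgK.
  have [e ea _] := wdistE a a s; exists e; split=> // g Gg etag.
  by case: none; exists g.
exists e => g Gg; rewrite invgM embV -mulgA -(aE _ Gg).
have [/(eE g Gg) //|] := boolP (linv (wdist a g.2) (cox_emb s)).
rewrite (linvP _ (emb_refl s)) => h; apply: (wdistL ea).
have [//|h'] := len_embM s (wdist a g.2).
by move: h; rewrite h' ltnSn.
Qed.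

Definition apartment_map (phi : W -> X) : Prop :=
  forall x y, wdist (phi x) (phi y) = x^-1 * y.

Lemma apartment_map_ex c d : exists phi, [/\ apartment_map phi, phi 1 = c &
  phi (wdist c d) = d].
Proof.
pose base : set (W * X) := [set g | g = (1, c) \/ g = (wdist c d, d)].
have isob : isometric base.
  move=> g h [] -> [] -> /=; rewrite ?wdistxx ?invg1 ?mul1g ?mulg1 ?mulVg //.
  by rewrite -wdistV.
pose P G := isometric (G `|` base).
have [F FP totF|G [PG maxG]] := @Zorn_bigcup _ P.
  move=> g h [[A FA Ag]|bg] [[B FB Bh]|bh]; last exact: isob.
  - by have [AB|BA] := totF _ _ FA FB; [apply: (FP _ FB)|apply: (FP _ FA)];
      left => //; [exact: AB|exact: BA].
  - by apply: (FP _ FA); [left|right].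
  - by apply: (FP _ FB); [right|left].
have total x : exists a, (G `|` base) (x, a).
  suff [u] : exists u, wprod u = x.
    elim/last_ind: u x => [|u s IHu] x.
      by rewrite wprod0 => <-; exists c; right; left.
    rewrite -cats1 wprod_cat wprod1 => <-; have [a Ga] := IHu _ erefl.
    have [e eE] := isometric_extend s PG Ga; exists e.
    apply: contrapT => nGe; apply: (maxG ((wprod u * cox_emb s, e) |` G)).
      split; first exact: subsetUr.
      move/(_ (wprod u * cox_emb s, e)); apply: contra_not nGe => h; left.
      by apply: h; left.
    have eE' h : (G `|` base) h -> wdist h.2 e = h.1^-1 * (wprod u * cox_emb s).
      by move=> Gh; rewrite wdistV eE // invgM invgK.
    by move=> g h [[->|Gg]|bg] [[->|Gh]|bh]; rewrite ?wdistxx ?mulVg //;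
      do ?[by apply: eE; (left + right)|by apply: eE'; (left + right)];
      apply: PG; by [left|right].
  exact: cox_surj.
pose phi x := sval (cid (total x)).
have phiG x : (G `|` base) (x, phi x) by rewrite /phi; case: cid.
have phiE x a : (G `|` base) (x, a) -> phi x = a.
  by move=> Ga; apply/wdist1; rewrite (PG _ _ (phiG x) Ga) mulVg.
exists phi; split; first by move=> x y; apply: (PG _ _ (phiG x) (phiG y)).
  by apply: phiE; right; left.
by apply: phiE; right; right.
Qed.

Section ApartmentMap.
Variables (phi : W -> X).
Hypothesis phiP : apartment_map phi.

Lemma apartment_map_inj : injective phi.
Proof.
move=> x y E; have := phiP x y; rewrite E wdistxx => /esym/mulg1_eq.
by rewrite invgK.
Qed.

Lemma preimage_residue_of J a x : residue_of J a (phi x) ->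
  phi @^-1` residue_of J a = lcoset J x.
Proof.
by move=> ax; rewrite -(residue_of_eq ax); apply/seteqP; split => y;
  rewrite /preimage /residue_of /lcoset /= phiP.
Qed.

Definition opposite_half y t : set X := phi @` [set z | sep y z t].

Lemma half_apartmentP x s : is_refl (x * cox_emb s * x^-1) /\
  [set c | range phi c /\
     (gallery_dist c (phi x) < gallery_dist c (phi (x * cox_emb s)))%N] =
  phi @` [set z | ~~ sep x z (x * cox_emb s * x^-1)].
Proof.
set t := x * _ * _; have tR : is_refl t by exists x, s.
have key z : (gallery_dist (phi z) (phi x) <
    gallery_dist (phi z) (phi (x * cox_emb s)))%N = ~~ sep x z t.
  rewrite !gallery_distE !phiP /sep addbC -/(sep z x t) (sepP _ _ tR).
  have <- : z^-1 * t * x = z^-1 * (x * cox_emb s) by rewrite /t !mulgA mulgVK.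
  have /eqP := len_refl_neq (w := z^-1 * x) (refl_conj z^-1 tR).
  rewrite invgK !mulgA mulgK; set m := len _; set n := len _.
  by rewrite -leqNgt [(n <= m)%N]leq_eqVlt eq_sym => /negbTE ->.
split=> //; apply/seteqP; split => [_ [[z _ <-]]|_ [z zx <-]].
  by rewrite key; exists z.
by split; [exists z|rewrite key].
Qed.

Lemma Phi_walls_off (R1 R2 : @residue W X) y : val R2 (phi y) ->
  Phi (range phi) R1 R2 =
    opposite_half y @` walls_off (phi @^-1` val R1) (phi @^-1` val R2).
Proof.
move=> R2y; apply/seteqP; split => [alpha [[c [d [[x _ <-] [z _ <-] [s cd] ->]]]]|].
  have {cd} -> : z = x * cox_emb s by rewrite -cd phiP mulVKg.
  have [tR ->] := half_apartmentP x s; set t := _ * _ * _ in tR *.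
  move=> [_ [[z1 zx <-] R1z1]] noR2.
  have R2x z2 : val R2 (phi z2) -> sep x z2 t.
    move=> R2z2; apply/negPn/negP => h; apply: noR2; exists (phi z2).
    by split=> //; exists z2.
  exists t.
    exists z1 => // z2 /R2x; move: zx; rewrite /= /sep.
    by case: (linv x t); case: (linv z1 t); case: (linv z2 t).
  congr image; apply/seteqP; split => z2 /=; move: (R2x _ R2y); rewrite /sep;
    by case: (linv x t); case: (linv y t); case: (linv z2 t).
move=> _ [t [z1 R1z1 h] <-]; have [x [s tE]] := sep_refl (h _ R2y).
have halfE : exists x' s', t = x' * cox_emb s' * x'^-1 /\ sep y x' t.
  have [yx|nyx] := boolP (sep y x t); first by exists x, s.
  exists (x * cox_emb s), s; split.
    by rewrite tE invgM embV !mulgA -[x * cox_emb s * cox_emb s]mulgA embK mulg1.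
  have xt : x^-1 * t * x = cox_emb s by rewrite tE !mulgA mulVg mul1g mulgVK.
  move: nyx; rewrite /sep linvM xt linv_emb eqxx.
  by case: (linv y t); case: (linv x t).
have [x' [s' [tE' yx']]] := halfE; have [_] := half_apartmentP x' s'.
rewrite -tE' => hE; split.
- exists (phi x'), (phi (x' * cox_emb s')); split; [by exists x'|by eexists| |].
    by exists s'; rewrite phiP mulKg.
  rewrite hE; congr image; apply/seteqP; split => z /=; move: yx'; rewrite /sep;
    by case: (linv x' t); case: (linv y t); case: (linv z t).
- exists (phi z1); split=> //; exists z1 => //=.
  by have := h _ R2y; rewrite /sep addbC.
- move=> [_ [[z2 yz2 <-] R2z2]]; have := h _ R2z2; have := h _ R2y; move: yz2.
  by rewrite /= /sep; case: (linv y t); case: (linv z1 t); case: (linv z2 t).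
Qed.

Lemma opposite_half_inj y t t' : is_refl t ->
  opposite_half y t = opposite_half y t' -> t = t'.
Proof.
move=> [x [s tE]] E.
have sepe z : sep y z t = sep y z t'.
  apply/idP/idP => h.
    have : opposite_half y t (phi z) by exists z.
    by rewrite E => -[z' h' /apartment_map_inj <-].
  have : opposite_half y t' (phi z) by exists z.
  by rewrite -E => -[z' h' /apartment_map_inj <-].
have : sep x (x * cox_emb s) t.
  by rewrite sepE mulKg linv_emb tE !mulgA mulVg mul1g mulgVK.
have -> : sep x (x * cox_emb s) t = sep x (x * cox_emb s) t'.
  move: (sepe x) (sepe (x * cox_emb s)); rewrite /sep.
  move: (linv y t) (linv y t') (linv x t) (linv x t').
  move: (linv _ t) (linv _ t').
  by do 6!case.
rewrite sepE mulKg linv_emb tE => /eqP <-.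
by rewrite !mulgA mulgV mul1g mulgK.
Qed.

End ApartmentMap.

Lemma card_Phi phi (R1 R2 : @residue W X) y : apartment_map phi ->
  val R2 (phi y) ->
  let D := walls_off (phi @^-1` val R1) (phi @^-1` val R2) in
  finite_set D ->
  #|` fset_set (Phi (range phi) R1 R2)| = #|` fset_set D|.
Proof.
move=> phiP R2y D fD; rewrite (Phi_walls_off phiP _ R2y) cardfs_image //.
move=> t t' [z _ /(_ _ R2y) /sep_refl tR] _; exact: (opposite_half_inj phiP tR).
Qed.

Definition hausdorff_from (A B : set X) (n : nat) : Prop :=
  (exists2 c, A c & forall e, B e -> (n <= gallery_dist c e)%N) /\
  (forall c, A c -> exists2 e, B e & (gallery_dist c e <= n)%N).

Definition excess (A B : set X) : nat := xget 0%N (hausdorff_from A B).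

Lemma hausdorff_from_le (A B : set X) m n :
  hausdorff_from A B m -> hausdorff_from A B n -> (m <= n)%N.
Proof.
move=> [[c Ac cm] _] [_ /(_ c Ac)[e Be]]; apply: leq_trans; exact: cm.
Qed.

Lemma excessE (A B : set X) n : hausdorff_from A B n -> excess A B = n.
Proof.
move=> h; rewrite /excess; case: xgetP => [m _ h'|/(_ n)//].
by apply/eqP; rewrite eqn_leq !(@hausdorff_from_le A B).
Qed.

Lemma hausdorff_walls_off phi J K a b x y : apartment_map phi ->
  finite_set (@parabolic W J) -> residue_of J a (phi x) ->
  residue_of K b (phi y) ->
  let D := walls_off (phi @^-1` residue_of J a) (phi @^-1` residue_of K b) in
  finite_set D /\
  hausdorff_from (residue_of J a) (residue_of K b) #|` fset_set D|.
Proof.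
move=> phiP fJ ax bY D; have [] := walls_off_hausdorff K x y fJ.
rewrite -!(preimage_residue_of phiP ax) -!(preimage_residue_of phiP bY) -/D.
move=> fD [c1 ac1 cmin] cmax; split=> //; split.
  exists (phi c1) => // e /(residue_of2 bY)/(wdist_right (phi c1))[k Kk E].
  rewrite gallery_distE E phiP -mulgA; apply: cmin.
  rewrite (preimage_residue_of phiP bY); exact: lcosetM.
move=> c ac; have [j Jj E] := wdist_left (phi y) (residue_of2 ac ax).
have [|e be le] := cmax (x * j^-1).
  rewrite (preimage_residue_of phiP ax); apply: lcosetM; exact: parV.
have Kye : parabolic K (y^-1 * e) by rewrite -phiP; apply: residue_of2 be.
have [e' ye' E'] := wdist_right_ex c (phi y) Kye.
exists e'; first by rewrite -(residue_of_eq bY).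
rewrite gallery_distE E' E phiP; move: le; rewrite invgM invgK -!mulgA.
by rewrite mulVKg.
Qed.

End Apartments.

Section RootDistance.
Variables (W : coxeter_system) (X : building W) (Rt : realType).
Local Notation S := (cox_gen W).
Local Notation resid := (@residue W X).
Implicit Types (J K : {set S}) (R Q sigma : resid) (A B C : set X).

Lemma hausdorff_excess R Q : Res_sph X R ->
  hausdorff_from (val R) (val Q) (excess (val R) (val Q)).
Proof.
move=> [J [a [fJ ->]]]; have /set_mem[K [b ->]] := valP Q.
have [phi [phiP phi1 phib]] := apartment_map_ex a b.
have aphi : residue_of J a (phi 1%g) by rewrite phi1; exact: residue_of_id.
have bphi : residue_of K b (phi (wdist a b)) by rewrite phib; exact: residue_of_id.
have [_ h] := hausdorff_walls_off phiP fJ aphi bphi.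
by rewrite (excessE h).
Qed.

Lemma excess_Phi phi x y R Q : apartment_map phi -> Res_sph X R ->
  val R (phi x) -> val Q (phi y) ->
  let D := walls_off (phi @^-1` val R) (phi @^-1` val Q) in
  finite_set D /\ excess (val R) (val Q) = #|` fset_set D|.
Proof.
move=> phiP [J [a [fJ RE]]]; have /set_mem[K [b QE]] := valP Q.
rewrite RE QE => ax bY.
by have [fD /excessE] := hausdorff_walls_off phiP fJ ax bY.
Qed.

Lemma root_distE R Q : Res_sph X R -> Res_sph X Q ->
  root_dist Rt R Q = 2^-1 * (excess (val R) (val Q))%:R +
                     2^-1 * (excess (val Q) (val R))%:R.
Proof.
move=> Rsph Qsph.
have val_ex (P : resid) : exists c, val P c.
  by have /set_mem[J [c ->]] := valP P; exists c; exact: residue_of_id.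
have key A : apartment A -> contains A R -> contains A Q ->
    #|` fset_set (Phi A R Q)| = excess (val R) (val Q).
  move=> [phi phiP ->] [_ [[x _ <-] Rx]] [_ [[y _ <-] Qy]].
  have [fD ->] := excess_Phi phiP Rsph Rx Qy.
  exact: card_Phi Qy fD.
have key' A : apartment A -> contains A R -> contains A Q ->
    #|` fset_set (Phi A Q R)| = excess (val Q) (val R).
  move=> [phi phiP ->] [_ [[x _ <-] Rx]] [_ [[y _ <-] Qy]].
  have [fD ->] := excess_Phi phiP Qsph Qy Rx.
  exact: card_Phi Rx fD.
have [[c Rc] [d Qd]] := (val_ex R, val_ex Q).
have [phi [phiP phi1 phid]] := apartment_map_ex c d.
apply: xget_unique => [|r [A [Aa AR AQ ->]]]; last by rewrite key // key'.
have Aa : apartment (range phi) by exists phi.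
have AR : contains (range phi) R by exists c; rewrite -{1}phi1; split.
have AQ : contains (range phi) Q by exists d; rewrite -{1}phid; split.
by exists (range phi); rewrite key // key'.
Qed.

Lemma excess_triangle R Q sigma : Res_sph X R -> Res_sph X Q ->
  (excess (val R) (val sigma) <=
   excess (val R) (val Q) + excess (val Q) (val sigma))%N.
Proof.
move=> Rsph Qsph; have [[c Rc cmin] _] := hausdorff_excess sigma Rsph.
have [_ /(_ c Rc)[d Qd cd]] := hausdorff_excess Q Rsph.
have [_ /(_ d Qd)[e se de]] := hausdorff_excess sigma Qsph.
apply: leq_trans (cmin e se) (leq_trans (gallery_dist_triangle c d e) _).
exact: leq_add.
Qed.

Lemma excess_sub R Q : val R `<=` val Q -> excess (val R) (val Q) = 0%N.
Proof.
move=> RQ; apply: excessE; have /set_mem[J [c E]] := valP R.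
split; first by exists c => //; rewrite E; exact: residue_of_id.
by move=> d /RQ Qd; exists d => //; rewrite gallery_distxx.
Qed.

Lemma excess0 R Q : Res_sph X R -> excess (val R) (val Q) = 0%N ->
  val R `<=` val Q.
Proof.
move=> Rsph E; have [_] := hausdorff_excess Q Rsph; rewrite E => h c /h[d Qd].
by rewrite leqn0 => /eqP/gallery_dist0 ->.
Qed.

Lemma proj_sph R sigma : Res_sph X sigma ->
  Res_sph X (val (Defs.proj sigma (val R))).
Proof.
move=> [K [b [fK sE]]]; have /set_mem[J [a RE]] := valP R.
have [I [p [IK bp E]]] := proj_set_residue_of sE J a.
exists I, p; split.
  apply: sub_finite_set fK => _ [u uI <-]; exists u => //.
  by apply: sub_all uI => k; apply: (fintype.subsetP IK).
by rewrite proj_val; [rewrite RE E|exact: valP].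
Qed.

Lemma excess_proj R sigma Q : Res_sph X R -> Res_sph X sigma -> Res_sph X Q ->
  val Q `<=` val sigma -> let P := val (Defs.proj sigma (val R)) in
  excess (val R) (val Q) =
    (excess (val R) (val sigma) + excess (val P) (val Q))%N /\
  (excess (val Q) (val R) + excess (val sigma) (val P) =
    excess (val sigma) (val R) + excess (val Q) (val P))%N.
Proof.
move=> Rsph ssph Qsph Qs P.
have Psph : Res_sph X P by exact: proj_sph.
have PE : val P = proj_set sigma (val R) by apply: proj_val; exact: valP.
have [J [a [fJ RE]]] := Rsph; have [K [b [fK sE]]] := ssph.
have Ra : val R a by rewrite RE; exact: residue_of_id.
have [q0 Qq0] : exists q, val Q q.
  by have [I [q [_ ->]]] := Qsph; exists q; exact: residue_of_id.
have [phi [phiP phi1 phiy]] := apartment_map_ex a q0; set y := wdist a q0 in phiy.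
have Rx : val R (phi 1%g) by rewrite phi1.
have Qy : val Q (phi y) by rewrite phiy.
have sy : val sigma (phi y) by exact: Qs.
have sC : phi @^-1` val sigma = lcoset K y.
  by rewrite sE; apply: preimage_residue_of => //; rewrite -sE.
have PC : phi @^-1` val P = coset_proj K y (phi @^-1` val R).
  apply/seteqP; split => z; rewrite /preimage /= PE.
    move=> [c Rc /(nearestP sE)[sz pz]].
    have [|j Jj E] := @wdist_left _ _ c (phi 1%g) (phi z) J.
      by rewrite RE in Rc Rx; exact: residue_of2 Rc Rx.
    exists j^-1%g.
      rewrite /= RE phi1 -[j^-1%g]mul1g in Rx *.
      by rewrite /residue_of /= -{1}phi1 phiP mulKg; exact: parV.
    by rewrite -sC /= sE invgK; split=> //; move: pz; rewrite E phiP invg1 mul1g.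
  move=> [c Rc [yz pz]]; exists (phi c) => //; apply/(nearestP sE).
  by rewrite phiP; split=> //; move: yz; rewrite -sC /= sE.
have A0 : phi @^-1` val R !=set0 by exists 1%g.
have BE : phi @^-1` val Q `<=` lcoset K y by rewrite -sC => z; exact: Qs.
have B0 : phi @^-1` val Q !=set0 by exists y.
have [z Pz] : exists z, val P (phi z).
  have [z yz pz] := gate_ex K 1%g y; exists z.
  suff : (phi @^-1` val P) z by [].
  by rewrite PC; exists 1%g.
have [f1 ->] := excess_Phi phiP Rsph Rx Qy.
have [f2 ->] := excess_Phi phiP Rsph Rx sy.
have [f3 ->] := excess_Phi phiP Psph Pz Qy.
have [f4 ->] := excess_Phi phiP Qsph Qy Rx.
have [f5 ->] := excess_Phi phiP ssph sy Pz.
have [f6 ->] := excess_Phi phiP ssph sy Rx.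
have [f7 ->] := excess_Phi phiP Qsph Qy Pz.
rewrite sC in f2 f5 f6 *; rewrite PC in f3 f5 f7 *.
split; first exact: card_walls_off_from.
exact: card_walls_off_to.
Qed.

End RootDistance.

(** * Closures in products of discrete spaces *)

Section ProductTopology.
Variables (I : choiceType) (K : I -> topologicalType).

Lemma nbhs_prodP (f : prod_topology K) (B : set (prod_topology K)) :
  nbhs f B <-> exists L : seq I, exists2 U : forall i, set (K i),
    (forall i, nbhs (f i) (U i)) &
    [set g : prod_topology K | forall i, i \in L -> U i (g i)] `<=` B.
Proof.
split=> [|[L [U nU sub]]]; last first.
  apply: filterS sub _; elim: L => [|i L IHL].
    by apply: filterS filterT => g _ i; rewrite in_nil.
  have ni : nbhs f [set g : prod_topology K | U i (g i)].
    by apply: (@proj_continuous _ K i f); exact: nU.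
  apply: filterS (filterI ni IHL) => g [gi gL] j.
  by rewrite in_cons => /orP[/eqP ->|/gL].
pose F : set_system (prod_topology K) := [set A | exists L : seq I,
  exists2 U : forall i, set (K i), (forall i, nbhs (f i) (U i)) &
    [set g : prod_topology K | forall i, i \in L -> U i (g i)] `<=` A].
have FF : Filter F.
  split.
  - by exists [::], (fun=> setT) => // i; exact: filterT.
  - move=> A A' [L [U nU sub]] [L' [U' nU' sub']].
    exists (L ++ L'), (fun i => U i `&` U' i).
      by move=> i; apply: filterI; [exact: nU|exact: nU'].
    move=> g gL; split.
      by apply: sub => i iL; have [] := gL i; rewrite ?mem_cat ?iL.
    by apply: sub' => i iL; have [] := gL i; rewrite ?mem_cat ?iL ?orbT.
  - by move=> A A' sub [L [U nU sub']]; exists L, U => // g /sub'/sub.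
suff : F --> f by apply.
apply/cvg_sup => i A [_ [[V oV <-] Vf] sub].
exists [:: i], (fun j => [set x | forall e : j = i, V (ecast i (K i) e x)]).
  move=> j; have [e|ne] := pselect (j = i); last first.
    by apply: filterS filterT => x _ e.
  case: _ / (esym e) => {j e}; apply: filterS (open_nbhs_nbhs (conj oV Vf)) => x Vx e.
  by rewrite (eq_irrelevance e (erefl i)).
by move=> g gi; apply: sub => /=; have := gi i (mem_head _ _) (erefl i).
Qed.

End ProductTopology.

Lemma closure_subspace (T : topologicalType) (A B : set T) : B `<=` A ->
  closure (B : set (subspace A)) = A `&` closure B.
Proof.
move=> BA; apply/seteqP; split => f.
  move=> cf; have Af : A f.
    apply: contrapT => nAf; have [|g [Bg gf]] := cf [set f].
      by case: (nbhs_subspaceP A f) => [//|_ x].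
    by apply: nAf; rewrite -[f]gf; apply: BA.
  split=> // C nC; apply: cf.
  by case: (nbhs_subspaceP A f) => // _; apply: cvg_within nC.
move=> [Af cf] C; case: (nbhs_subspaceP A f) => // _ /cf[g [Bg gC]].
by exists g; split=> //; apply: gC; exact: BA.
Qed.

(** When every value of [b z] is determined by finitely many values of [a z],
    [transfer] sends limit points of the family [a] to limit points of [b];
    conversely for the inverse map, by exchanging the roles of [a] and [b]. *)
Section Transfer.
Variables (Y : choiceType) (y0 : Y).

Section Limits.
Variables (I : choiceType) (T : I -> Type) (a : Y -> forall i, T i).

Definition approx (f : forall i, T i) : Prop :=
  forall L : seq I, exists z, forall i, i \in L -> a z i = f i.

End Limits.

Section Determined.
Variables (I J : choiceType) (T : I -> Type) (U : J -> Type).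
Variables (a : Y -> forall i, T i) (b : Y -> forall j, U j) (G : J -> seq I).

Definition determined : Prop := forall j z z',
  (forall i, i \in G j -> a z i = a z' i) -> b z j = b z' j.

Definition transfer (f : forall i, T i) : forall j, U j :=
  fun j => b (xget y0 [set z | forall i, i \in G j -> a z i = f i]) j.

Hypothesis det : determined.

Lemma transferE f j z : (forall i, i \in G j -> a z i = f i) ->
  transfer f j = b z j.
Proof.
move=> zf; apply: det => i iG; rewrite zf //.
by have := xgetI y0 (P := [set z | forall i, i \in G j -> a z i = f i]) zf; apply.
Qed.

Lemma approx_cover f (L : seq J) (L' : seq I) : approx a f ->
  exists z, (forall i, i \in L' -> a z i = f i) /\
    forall j, j \in L -> transfer f j = b z j.
Proof.
move=> /(_ (L' ++ flatten (map G L)))[z zf]; exists z; split=> [i iL'|j jL].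
  by apply: zf; rewrite mem_cat iL'.
apply: transferE => i iG; apply: zf; rewrite mem_cat; apply/orP; right.
by apply/flattenP; exists (G j) => //; exact: map_f.
Qed.

Lemma transfer_approx f : approx a f -> approx b (transfer f).
Proof.
by move=> /approx_cover fa L; have [z [_ zb]] := fa L [::]; exists z => j /zb.
Qed.

End Determined.

Lemma transferK (I J : choiceType) (T : I -> Type) (U : J -> Type)
    (a : Y -> forall i, T i) (b : Y -> forall j, U j)
    (G : J -> seq I) (F : I -> seq J) f :
  determined a b G -> determined b a F -> approx a f ->
  transfer b a F (transfer a b G f) = f.
Proof.
move=> detG detF fa; apply: functional_extensionality_dep => i.
have [z [zi zF]] := approx_cover detG (F i) [:: i] fa.
rewrite (transferE detF (z := z)); first by apply: zi; rewrite mem_head.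
by move=> j /zF.
Qed.

Lemma transfer_continuous (I J : choiceType) (T : I -> topologicalType)
    (U : J -> topologicalType)
    (a : Y -> forall i, T i) (b : Y -> forall j, U j) (G : J -> seq I)
    (C : set (prod_topology T)) :
  determined a b G -> (forall f, C f -> approx a f) ->
  (forall f (L : seq I), C f -> \forall g \near within C (nbhs f),
     forall i, i \in L -> g i = f i) ->
  {within C, continuous (transfer a b G : prod_topology T -> prod_topology U)}.
Proof.
move=> detG Ca near_eq; apply/subspace_continuousP => f Cf B.
move=> /nbhs_prodP[L [V nV sub]].
have Cnear : \forall g \near within C (nbhs f), C g by exact: withinT.
apply: filterS2 (near_eq f (flatten (map G L)) Cf) Cnear => g gf Cg.
apply: sub => j jL.
suff E : transfer a b G g j = transfer a b G f j.
  by change (V j (transfer a b G g j)); rewrite E; exact: nbhs_singleton (nV j).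
have [z [zg _]] := approx_cover detG [::] (G j) (Ca _ Cg).
rewrite !(transferE detG (z := z)) // => i iG; rewrite zg // gf //.
by apply/flattenP; exists (G j) => //; exact: map_f.
Qed.

End Transfer.

Section Homeomorphism.
Variables (R : realType) (Y I : choiceType) (T : I -> choiceType).
Local Notation E := (prod_topology (fun i : I => discrete_topology (T i))).
Variables (a : Y -> E) (dist : Y -> Y -> R) (y0 : Y).
Local Notation b := (fun z => dist_fun dist y0 z : Y -> R).

Lemma near_agree (f : E) (L : seq I) :
  \forall g \near f, forall i, i \in L -> g i = f i.
Proof.
apply/nbhs_prodP; exists L, (fun i => [set f i]).
  by move=> i; rewrite nbhs_principalE.
by move=> g gL i iL; exact: gL.
Qed.

Lemma closure_approx f : closure (range a) f <-> approx a f.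
Proof.
split=> [cf L|fa B /nbhs_prodP[L [U nU sub]]].
  have [_ [[z _ <-] zf]] := cf _ (near_agree f L).
  by exists z.
have [z zf] := fa L; exists (a z); split; first by exists z.
by apply: sub => i /zf ->; exact: nbhs_singleton.
Qed.

Hypothesis dist_lip : forall p x y, `|dist p x - dist p y| <= dist x y.
Hypothesis dist_half : forall x y, exists n : nat, dist x y = n%:R / 2.

Lemma dist_fun_half z y : exists m : int, b z y = m%:~R / 2.
Proof.
have [n En] := dist_half z y; have [n0 En0] := dist_half z y0.
exists (n%:Z - n0%:Z); rewrite /dist_fun En En0 rmorphB /= !pmulrn.
by rewrite mulrBl.
Qed.

Lemma half_int_close (x y : R) : (exists m : int, x = m%:~R / 2) ->
  (exists m : int, y = m%:~R / 2) -> `|x - y| < 2^-1 -> x = y.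
Proof.
move=> [m ->] [n ->]; rewrite -mulrBl -intrB normrM.
rewrite (@ger0_norm _ 2^-1) ?invr_ge0 //.
rewrite -[ltRHS]mul1r ltr_pM2r ?invr_gt0 // -intr_norm.
rewrite -[1%R]/(1%:~R) ltr_int => h.
suff -> : m = n by [].
by apply/eqP; rewrite -subr_eq0 -normr_le0; lia.
Qed.

Lemma horofunctionP f :
  horofunction_compactification dist y0 f <-> approx b f.
Proof.
have lipb z : lipschitz1_at dist y0 (b z).
  split; first by rewrite /dist_fun subrr.
  by move=> x y; rewrite /dist_fun opprB addrA addrNK; exact: dist_lip.
have near_ball (g : {ptws Y -> R}) (L : seq Y) (e : R) : 0 < e ->
    nbhs g [set g' : {ptws Y -> R} | forall y, y \in L -> `|g y - g' y| < e].
  move=> e0; apply/nbhs_prodP; exists L, (fun y => [set x | `|g y - x| < e]) => //.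
  by move=> y; apply: (@nbhsx_ballx R R^o (g y) e).
have rangeb : range b `<=` lipschitz1_at dist y0.
  by move=> _ [z _ <-]; exact: lipb.
rewrite /horofunction_compactification (@closure_subspace {ptws Y -> R} _ _ rangeb).
split=> [[_ cf]|fa].
  have close (L : seq Y) (e : R) : 0 < e ->
      exists z, forall y, y \in L -> `|f y - b z y| < e.
    by move=> /(near_ball f L)/cf[_ [[z _ <-] zf]]; exists z.
  move=> L; have [|z zf] := close L (4^-1); first by rewrite invr_gt0.
  exists z => y yL; apply/eqP; rewrite -subr_eq0 -normr_le0 distrC.
  apply/ler_addgt0Pl => e e0; rewrite addr0.
  have [|z' z'f] := close L (Num.min e 4^-1).
    by rewrite lt_min invr_gt0 ltr0n andbT.
  have := z'f y yL; rewrite lt_min => /andP[h1 h2].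
  have -> : b z y = b z' y; last exact: ltW.
  apply: half_int_close; try exact: dist_fun_half.
  have h3 := zf y yL; apply: le_lt_trans (ler_distD (f y) _ _) _.
  by rewrite distrC; lra.
split.
  split.
    by have [z <-] := fa [:: y0]; rewrite ?mem_head // /dist_fun subrr.
  move=> x y; have [z zf] := fa [:: x; y]; rewrite -!zf ?inE ?eqxx ?orbT //.
  by have [_] := lipb z; apply.
move=> B /nbhs_prodP[L [U nU sub]].
have [z zf] := fa L; exists (b z); split; first by exists z.
by apply: sub => y /zf ->; exact: nbhs_singleton.
Qed.

Lemma horofunction_near_agree f (L : seq Y) :
  horofunction_compactification dist y0 f ->
  \forall g \near within (horofunction_compactification dist y0)
      (nbhs (f : {ptws Y -> R})), forall y, y \in L -> g y = f y.
Proof.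
move=> /horofunctionP fa.
have half g y : approx b g -> exists m : int, g y = m%:~R / 2.
  move=> /(_ [:: y])[z zg]; have [m E] := dist_fun_half z y.
  by exists m; rewrite -E zg // mem_head.
have near_f : nbhs (f : {ptws Y -> R})
    [set g : {ptws Y -> R} | forall y, y \in L -> `|f y - g y| < 2^-1].
  apply/nbhs_prodP; exists L, (fun y => [set x | `|f y - x| < 2^-1]) => //.
  by move=> y; apply: (@nbhsx_ballx R R^o (f y)); rewrite invr_gt0.
rewrite near_withinE; apply: filterS near_f => g gf Cg y yL.
have /horofunctionP ga := Cg.
by apply/esym/half_int_close; [exact: half|exact: half|exact: gf].
Qed.

Variables (G : Y -> seq I) (F : I -> seq Y).
Hypotheses (detG : determined a b G) (detF : determined b a F).
Let h : E -> {ptws Y -> R} := transfer y0 a b G.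

Lemma transfer_homeomorphism :
  homeomorphism_on (closure (range a)) (horofunction_compactification dist y0) h.
Proof.
exists (transfer y0 b a F); split.
- by move=> f /closure_approx fa; apply/horofunctionP; exact: transfer_approx.
- by move=> g /horofunctionP ga; apply/closure_approx; exact: transfer_approx.
- split=> [f /set_mem/closure_approx|g /set_mem/horofunctionP];
    exact: transferK.
- apply: transfer_continuous => // [f /closure_approx //|f L _].
  by apply: cvg_within; exact: near_agree.
- apply: transfer_continuous => // [f /horofunctionP //|f L].
  exact: horofunction_near_agree.
Qed.

Variables (g gV : Y -> Y) (act : E -> E) (sigma : I -> I).
Hypothesis act_a : forall z, act (a z) = a (g z).
Hypothesis act_local : forall f f' i,
  f (sigma i) = f' (sigma i) -> act f i = act f' i.
Hypothesis dist_g : forall z y, dist (g z) y = dist z (gV y).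

Lemma transfer_equivariant f : closure (range a) f ->
  closure (range a) (act f) /\ h (act f) = horo_act y0 gV (h f).
Proof.
move=> /closure_approx fa; split.
  apply/closure_approx => L; have [z zf] := fa (map sigma L).
  by exists (g z) => i iL; rewrite -act_a; apply: act_local; rewrite zf // map_f.
apply: funext => y.
have [z [zf zh]] := approx_cover y0 detG [:: gV y; gV y0] (map sigma (G y)) fa.
rewrite /horo_act /h !zh ?inE ?eqxx ?orbT // (transferE y0 detG (z := g z)).
  by rewrite /dist_fun !dist_g opprB addrA addrNK.
by move=> i iG; rewrite -act_a; apply: act_local; rewrite zf // map_f.
Qed.

End Homeomorphism.

(** * The two compactifications *)

Section Automorphisms.
Variables (W : coxeter_system) (X : building W).
Implicit Types (g : building_aut X) (sigma : @residue W X) (A B : set X).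

Lemma aut_gallery_dist g (c d : X) : gallery_dist (g c) (g d) = gallery_dist c d.
Proof.
have le g' (c' d' : X) : (gallery_dist (g' c') (g' d') <= gallery_dist c' d')%N.
  rewrite [leqRHS]gallery_distE; move: c' d'.
  apply: wdist_ind => [e|s e e' d' e'e _ l IH]; first by rewrite gallery_distxx.
  rewrite l; apply: leq_trans (gallery_dist_triangle _ (g' e') _) _.
  have [phi [_ _ [p _ pE]] phiE] := aut_wdist g'.
  by rewrite [gallery_dist (g' e) _]gallery_distE phiE (wdist_emb_sym e'e) pE
    len_emb add1n ltnS.
by apply/eqP; rewrite eqn_leq le -{1}(aut_funK g c) -{1}(aut_funK g d) (le (autV g)).
Qed.

Lemma aut_nearest g sigma c d :
  nearest (aut_res (autV g) sigma) c d <-> nearest sigma (g c) (g d).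
Proof.
split=> -[sd min]; split.
- by move: sd => -[e se <-] /=; rewrite aut_invK.
- move=> e se; rewrite -(aut_invK g e) !aut_gallery_dist; apply: min.
  by exists e.
- by exists (g d) => //=; rewrite aut_funK.
- move=> _ [e se <-] /=; rewrite -(aut_gallery_dist g) -[leqRHS](aut_gallery_dist g).
  by rewrite aut_invK; exact: min.
Qed.

Lemma aut_proj_set g sigma A :
  g @` proj_set (aut_res (autV g) sigma) A = proj_set sigma (g @` A).
Proof.
apply/seteqP; split => [_ [d [c Ac cd] <-]|d [_ [c Ac <-] cd]].
  by exists (g c); [exists c|apply/aut_nearest].
exists (aut_inv g d); last exact: aut_invK.
by exists c => //; apply/aut_nearest; rewrite aut_invK.
Qed.

Lemma star_inj sigma (P Q : star sigma) : val (val P) = val (val Q) -> P = Q.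
Proof. by move=> E; do 2!apply: val_inj. Qed.

Lemma prod_act_proj (I : set (@residue W X)) (sI : aut_stable I) g A :
  A \in @residue W X ->
  prod_act sI g (@proj_map W X I A) = @proj_map W X I (g @` A).
Proof.
move=> resA; apply: functional_extensionality_dep => sigma; apply: star_inj.
rewrite /prod_act /proj_map /= !proj_val //; first exact: aut_proj_set.
exact: valP (aut_res g (SigSub resA)).
Qed.

Lemma prod_act_local (I : set (@residue W X)) (sI : aut_stable I) g
    (f f' : star_prod I) (sigma : I) :
  f (aut_act sI (autV g) sigma) = f' (aut_act sI (autV g) sigma) ->
  prod_act sI g f sigma = prod_act sI g f' sigma.
Proof. by move=> E; apply: val_inj; rewrite /prod_act /= E. Qed.

Lemma aut_excess g A B : excess (g @` A) (g @` B) = excess A B.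
Proof.
rewrite /excess; congr (xget _ _); apply/seteqP; split => n [[c Ac cmin] cmax].
  split; first case: Ac cmin => c' Ac' <- cmin.
    by exists c' => // e Be; rewrite -(aut_gallery_dist g); apply: cmin; exists e.
  move=> c' Ac'; have [|_ [e Be <-] le] := cmax (g c'); first by exists c'.
  by exists e; rewrite // -(aut_gallery_dist g).
split.
  exists (g c); first by exists c.
  by move=> _ [e Be <-]; rewrite aut_gallery_dist; exact: cmin.
move=> _ [c' Ac' <-]; have [e Be le] := cmax c' Ac'.
by exists (g e); [exists e|rewrite aut_gallery_dist].
Qed.

Lemma aut_root_dist (Rt : realType) g (R Q : @residue W X) :
  Res_sph X R -> Res_sph X Q ->
  root_dist Rt (aut_res g R) (aut_res g Q) = root_dist Rt R Q.
Proof.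
move=> Rsph Qsph; have sph P : Res_sph X P -> Res_sph X (aut_res g P).
  by move=> /mem_set/(aut_stable_sph X g)/set_mem.
by rewrite !root_distE ?aut_excess //; exact: sph.
Qed.

End Automorphisms.

Section SphericalResidues.
Variables (W : coxeter_system) (X : building W).
Local Open Scope group_scope.

Lemma parabolic_finite0 : finite_set (@parabolic W finset.set0).
Proof.
apply: sub_finite_set (finite_set1 1) => _ [[|s u] su <-] /=; first exact: wprod0.
by move: su; rewrite /= inE.
Qed.

Lemma residue_of_set0 (c : X) : residue_of finset.set0 c = [set c].
Proof.
apply/seteqP; split => [d [[|s u] su]|_ ->]; last exact: residue_of_id.
  by rewrite wprod0 => /esym/wdist1.
by move: su; rewrite /= inE.
Qed.

Lemma set1_residue (c : X) : [set c] \in @residue W X.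
Proof. by apply/mem_set; exists finset.set0, c; rewrite residue_of_set0. Qed.

Definition chamber_residue (c : X) : @residue W X := SigSub (set1_residue c).

Lemma chamber_residue_sph c : Res_sph X (chamber_residue c).
Proof.
by exists finset.set0, c; split; [exact: parabolic_finite0|rewrite residue_of_set0].
Qed.

Lemma parabolic_finite1 (s : cox_gen W) : finite_set (@parabolic W [set s]%SET).
Proof.
apply: sub_finite_set (finite_set2 1 (cox_emb s)) => _ [u us <-].
elim: u us => [|s' u IHu] /=; first by left; exact: wprod0.
rewrite inE => /andP[/eqP -> /IHu[] E]; rewrite wprod_cons E.
  by right; rewrite mulg1.
by left; exact: embK.
Qed.

Lemma Res_1_sph : Res_1 X `<=` Res_sph X.
Proof.
move=> R [s [c E]]; exists [set s]%SET, c; split=> //.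
exact: parabolic_finite1.
Qed.

Lemma panel_ex (c d : X) : adjacent c d ->
  exists sigma, [/\ Res_1 X sigma, val sigma c & val sigma d].
Proof.
move=> [s cd].
have res : residue_of [set s]%SET c \in @residue W X.
  by apply/mem_set; exists [set s]%SET, c.
exists (SigSub res); split=> /=; [by exists s, c|exact: residue_of_id|].
by rewrite /residue_of /= cd; apply: par_emb; rewrite inE.
Qed.

Lemma finite_residue (sigma : @residue W X) : finite_set (star sigma) ->
  finite_set (val sigma).
Proof.
have [c0 _] := chamber_ex X; move=> fs.
pose center (R : @residue W X) := xget c0 (val R).
apply: sub_finite_set (finite_image center fs) => c sc.
exists (chamber_residue c); first by move=> _ ->.
by apply: xget_unique.
Qed.

End SphericalResidues.

Section ChamberCompactification.
Variables (Rt : realType) (W : coxeter_system) (X : building W).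
Hypothesis lfX : locally_finite X.
Variable c0 : X.
Let dist (c d : X) : Rt := (gallery_dist c d)%:R.
Let a (c : X) : star_prod (Res_1 X) := @proj_map W X (Res_1 X) [set c].

Let aE z sigma : val (val (a z sigma)) = [set d | nearest (val sigma) z d].
Proof.
rewrite proj_val; last exact: set1_residue.
by apply/seteqP; split => [d [_ ->]|d zd] //; exists z.
Qed.

Lemma gallery_dist_lip p x y : `|dist p x - dist p y| <= dist x y.
Proof.
have h1 := gallery_dist_triangle p x y; have h2 := gallery_dist_triangle p y x.
rewrite (gallery_distC y x) in h2; rewrite -!(ler_nat Rt) !natrD in h1 h2.
by rewrite ler_norml /dist; apply/andP; split; lra.
Qed.

Lemma chamber_dist_determined y : exists G : seq (Res_1 X), forall z z',
  (forall sigma, sigma \in G -> a z sigma = a z' sigma) ->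
  dist_fun dist c0 z y = dist_fun dist c0 z' y.
Proof.
pose det (c d : X) := exists G : seq (Res_1 X), forall z z',
  (forall sigma, sigma \in G -> a z sigma = a z' sigma) ->
  dist z c - dist z d = dist z' c - dist z' d.
suff : det y c0 by [].
move: y c0; apply: wdist_ind => [c|s c c' d c'c _ _ [G IH]].
  by exists [::] => z z' _; rewrite !subrr.
have [sigma [panel sc' sc]] := panel_ex (ex_intro _ s c'c).
exists (SigSub (mem_set panel) :: G) => z z' zz'.
have := IH z z' (fun tau tG => zz' tau (mem_behead (s := _ :: _) tG)).
have /set_mem[K [b sE]] := valP sigma.
have [p zp] := nearest_ex sE z.
have z'p : nearest sigma z' p.
  have := congr1 (fun P => val (val P)) (zz' _ (mem_head _ _)).
  by rewrite !aE => /seteqP[/(_ p zp)].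
have e1 := nearest_dist sE zp sc; have e2 := nearest_dist sE zp sc'.
have e3 := nearest_dist sE z'p sc; have e4 := nearest_dist sE z'p sc'.
by rewrite /dist e1 e2 e3 e4 !natrD; lra.
Qed.

Lemma chamber_proj_determined (sigma : Res_1 X) : exists F : seq X, forall z z',
  (forall y, y \in F -> dist_fun dist c0 z y = dist_fun dist c0 z' y) ->
  a z sigma = a z' sigma.
Proof.
have fs : finite_set (val (val sigma)).
  by apply/finite_residue/lfX/Res_1_sph/set_mem; exact: valP.
exists (fset_set (val (val sigma))) => z z' E; apply: star_inj; rewrite !aE.
suff sub z1 z2 : (forall y, val (val sigma) y ->
    dist_fun dist c0 z1 y = dist_fun dist c0 z2 y) ->
    [set d | nearest (val sigma) z1 d] `<=` [set d | nearest (val sigma) z2 d].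
  have E' y : val (val sigma) y -> dist_fun dist c0 z y = dist_fun dist c0 z' y.
    by move=> sy; apply: E; rewrite in_fset_set // inE.
  by apply/seteqP; split; apply: sub => // y /E'.
move=> zz d [sd min]; split=> // e se; have := min e se.
rewrite -!(ler_nat Rt) => h; have := zz d sd; have := zz e se.
by rewrite /dist_fun /dist; lra.
Qed.

Lemma chamber_compactification :
  exists h : star_prod (Res_1 X) -> {ptws X -> Rt},
    homeomorphism_on (C_1 X) (horofunction_compactification dist c0) h /\
    forall (g : building_aut X) (f : star_prod (Res_1 X)), C_1 X f ->
      C_1 X (prod_act (aut_stable_1 X) g f) /\
      h (prod_act (aut_stable_1 X) g f) = horo_act c0 (autV g) (h f).
Proof.
have [G GP] := choice chamber_dist_determined.
have [F FP] := choice chamber_proj_determined.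
have half x y : exists n : nat, dist x y = n%:R / 2.
  by exists (gallery_dist x y * 2)%N; rewrite natrM mulfK // pnatr_eq0.
exists (transfer c0 a (dist_fun dist c0) G); split.
  exact: (transfer_homeomorphism gallery_dist_lip half GP FP).
move=> g f Cf.
apply: (@transfer_equivariant _ _ _ _ a dist c0 G GP g (autV g)
  (prod_act (aut_stable_1 X) g) (aut_act (aut_stable_1 X) (autV g)) _ _ _ f Cf).
- by move=> z; rewrite prod_act_proj ?image_set1 //; exact: set1_residue.
- exact: prod_act_local.
- move=> z y; rewrite /dist -{1}(aut_invK g y) aut_gallery_dist //.
Qed.

End ChamberCompactification.

Section SphericalCompactification.
Variables (Rt : realType) (W : coxeter_system) (X : building W).
Hypothesis lfX : locally_finite X.
Variable s0 : Res_sph X.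
Let d (R Q : @residue W X) : Rt := root_dist Rt R Q.
Let dist (s s' : Res_sph X) : Rt := d (val s) (val s').
Let a (R : Res_sph X) : star_prod (Res_sph X) :=
  @proj_map W X (Res_sph X) (val (val R)).

Let sphP (R : Res_sph X) : Res_sph X (val R).
Proof. by apply: set_mem; exact: valP. Qed.

Lemma root_dist_lip p x y : `|dist p x - dist p y| <= dist x y.
Proof.
rewrite /dist /d !root_distE //.
have h1 := excess_triangle (val y) (sphP p) (sphP x).
have h2 := excess_triangle (val x) (sphP p) (sphP y).
have h3 := excess_triangle (val p) (sphP x) (sphP y).
have h4 := excess_triangle (val p) (sphP y) (sphP x).
rewrite -!(ler_nat Rt) !natrD in h1 h2 h3 h4.
by rewrite ler_norml; apply/andP; split; lra.
Qed.

(** [proj_sigma R] carries the position of [R] relative to the walls that cut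
    [sigma]; no other wall distinguishes [Q] from [sigma]. *)
Lemma root_dist_proj (R sigma Q : @residue W X) :
  Res_sph X R -> Res_sph X sigma -> Res_sph X Q -> val Q `<=` val sigma ->
  let P := val (Defs.proj sigma (val R)) in
  d R Q - d R sigma = d P Q - d P sigma.
Proof.
move=> Rsph ssph Qsph Qs P; have Psph : Res_sph X P by exact: proj_sph.
have Ps : val P `<=` val sigma := set_mem (valP (Defs.proj sigma (val R))).
rewrite /d !root_distE // (excess_sub Ps).
have [-> E] := excess_proj Rsph ssph Qsph Qs; rewrite -/P in E *.
have := congr1 (fun n => n%:R : Rt) E; rewrite !natrD.
by lra.
Qed.

Lemma root_dist0 (R Q : @residue W X) : Res_sph X R -> Res_sph X Q ->
  d R Q = 0 -> R = Q.
Proof.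
move=> Rsph Qsph; rewrite /d root_distE // -mulrDr -natrD => /eqP.
rewrite mulf_eq0 invr_eq0 !pnatr_eq0 /= addn_eq0 => /andP[/eqP RQ /eqP QR].
by apply/val_inj/seteqP; split; exact: excess0.
Qed.

Lemma root_distxx (R : @residue W X) : Res_sph X R -> d R R = 0.
Proof. by move=> Rsph; rewrite /d root_distE // excess_sub // mulr0 addr0. Qed.

Lemma root_distC (R Q : @residue W X) : Res_sph X R -> Res_sph X Q ->
  d R Q = d Q R.
Proof. by move=> Rsph Qsph; rewrite /d !root_distE // addrC. Qed.

Let determined_diff (R Q : @residue W X) : Prop :=
  exists G : seq (Res_sph X), forall z z',
    (forall sigma, sigma \in G -> a z sigma = a z' sigma) ->
    d (val z) R - d (val z) Q = d (val z') R - d (val z') Q.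

Let diff_sym R Q : determined_diff R Q -> determined_diff Q R.
Proof.
by move=> [G GP]; exists G => z z' /GP; lra.
Qed.

Let diff_trans Q R P :
  determined_diff R Q -> determined_diff Q P -> determined_diff R P.
Proof.
move=> [G GP] [G' GP']; exists (G ++ G') => z z' E.
have e1 : d (val z) R - d (val z) Q = d (val z') R - d (val z') Q.
  by apply: GP => s sG; apply: E; rewrite mem_cat sG.
have e2 : d (val z) Q - d (val z) P = d (val z') Q - d (val z') P.
  by apply: GP' => s sG; apply: E; rewrite mem_cat sG orbT.
by lra.
Qed.

Let diff_face R sigma : Res_sph X R -> Res_sph X sigma -> val R `<=` val sigma ->
  determined_diff R sigma.
Proof.
move=> Rsph ssph Rs; exists [:: SigSub (mem_set ssph)] => z z' E.
pose sg : Res_sph X := SigSub (mem_set ssph).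
have zz' : val (a z sg) = val (a z' sg) by rewrite (E sg (mem_head _ _)).
have e (x : Res_sph X) : d (val x) R - d (val x) sigma =
    d (val (a x sg)) R - d (val (a x sg)) sigma.
  exact: (root_dist_proj (sphP x) ssph Rsph Rs).
by rewrite !e zz'.
Qed.

Lemma residue_dist_determined (y : Res_sph X) :
  exists G : seq (Res_sph X), forall z z',
    (forall sigma, sigma \in G -> a z sigma = a z' sigma) ->
    dist_fun dist s0 z y = dist_fun dist s0 z' y.
Proof.
suff : determined_diff (val y) (val s0) by [].
have chamber_of (R : Res_sph X) :
    exists c, determined_diff (chamber_residue c) (val R).
  have [J [c [_ E]]] := sphP R; exists c; apply: diff_face => //.
    exact: chamber_residue_sph.
  by move=> _ ->; rewrite E; exact: residue_of_id.
have [[c yc] [c' s0c]] := (chamber_of y, chamber_of s0).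
apply: diff_trans (diff_sym yc) (diff_trans _ s0c).
move: c c' {yc s0c}; apply: wdist_ind => [c|s c c1 c2 c1c _ _].
  by exists [::] => z z' _; rewrite !subrr.
have [sigma [/Res_1_sph ssph sc1 sc]] := panel_ex (ex_intro _ s c1c).
have face e : val sigma e -> determined_diff (chamber_residue e) sigma.
  by move=> se; apply: diff_face => //; [exact: chamber_residue_sph|move=> _ ->].
by apply: diff_trans; apply: diff_trans (face _ sc) (diff_sym (face _ sc1)).
Qed.

Lemma residue_proj_determined (sigma : Res_sph X) :
  exists F : seq (Res_sph X), forall z z',
    (forall y, y \in F -> dist_fun dist s0 z y = dist_fun dist s0 z' y) ->
    a z sigma = a z' sigma.
Proof.
pose faces : set (Res_sph X) := [set Q | star (val sigma) (val Q)].
have ffaces : finite_set faces.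
  apply: (@finite_preimage _ _ _ val); last exact/lfX/sphP.
  by move=> x y _ _; exact: val_inj.
exists (fset_set faces) => z z' E.
have {}E (Q Q' : @residue W X) : Res_sph X Q -> Res_sph X Q' ->
    val Q `<=` val (val sigma) -> val Q' `<=` val (val sigma) ->
    d (val z) Q - d (val z) Q' = d (val z') Q - d (val z') Q'.
  move=> Qsph Q'sph Qs Q's.
  have := E (SigSub (mem_set Qsph)); have := E (SigSub (mem_set Q'sph)).
  rewrite !in_fset_set // !inE /= /dist_fun /dist /= => /(_ Q's) h1 /(_ Qs) h2.
  by lra.
pose P := val (a z sigma); pose P' := val (a z' sigma).
have Psph : Res_sph X P by exact: proj_sph.
have P'sph : Res_sph X P' by exact: proj_sph.
have Ps : val P `<=` val (val sigma) := set_mem (valP (a z sigma)).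
have P's : val P' `<=` val (val sigma) := set_mem (valP (a z' sigma)).
suff PP' : P = P' by apply: val_inj.
apply: root_dist0 => //; have := E P P' Psph P'sph Ps P's.
have := root_dist_proj (sphP z) (sphP sigma) Psph Ps.
have := root_dist_proj (sphP z) (sphP sigma) P'sph P's.
have := root_dist_proj (sphP z') (sphP sigma) Psph Ps.
have := root_dist_proj (sphP z') (sphP sigma) P'sph P's.
rewrite -[val (Defs.proj _ (val (val z)))]/P -[val (Defs.proj _ (val (val z')))]/P'.
rewrite /= (root_distxx Psph) (root_distxx P'sph) (root_distC P'sph Psph).
have arith (r s u v v' w w' t t' : Rt) : w' - t' = 0 - u -> v' - t' = r - u ->
    w - t = r - s -> v - t = 0 - s -> v - w = v' - w' -> r = 0 by lra.
exact: arith.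
Qed.

Lemma residue_compactification :
  exists h : star_prod (Res_sph X) -> {ptws Res_sph X -> Rt},
    homeomorphism_on (C_sph X) (horofunction_compactification dist s0) h /\
    forall (g : building_aut X) (f : star_prod (Res_sph X)), C_sph X f ->
      C_sph X (prod_act (aut_stable_sph X) g f) /\
      h (prod_act (aut_stable_sph X) g f) =
        horo_act s0 (aut_act (aut_stable_sph X) (autV g)) (h f).
Proof.
have [G GP] := choice residue_dist_determined.
have [F FP] := choice residue_proj_determined.
have half x y : exists n : nat, dist x y = n%:R / 2.
  exists (excess (val (val x)) (val (val y)) +
          excess (val (val y)) (val (val x)))%N.
  by rewrite /dist /d root_distE // -mulrDr -natrD mulrC.
exists (transfer s0 a (dist_fun dist s0) G); split.
  exact: (transfer_homeomorphism root_dist_lip half GP FP).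
move=> g f Cf.
apply: (@transfer_equivariant _ _ _ _ a dist s0 G GP
  (aut_act (aut_stable_sph X) g) (aut_act (aut_stable_sph X) (autV g))
  (prod_act (aut_stable_sph X) g) (aut_act (aut_stable_sph X) (autV g)) _ _ _ f Cf).
- by move=> z; rewrite prod_act_proj //; exact: valP.
- exact: prod_act_local.
- move=> z y; rewrite /dist /d -{1}(aut_resK g (val y)) aut_root_dist //.
  exact: sphP (aut_act (aut_stable_sph X) (autV g) y).
Qed.

End SphericalCompactification.

Theorem theorem3p1 (R : realType) (W : coxeter_system) (X : building W)
    (lfX : locally_finite X) :
  (forall c0 : X,
     let d := fun c c' : X => (gallery_dist c c')%:R : R in
     exists h : star_prod (Res_1 X) -> {ptws X -> R},
       homeomorphism_on (C_1 X) (horofunction_compactification d c0) h /\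
       forall (g : building_aut X) (f : star_prod (Res_1 X)), C_1 X f ->
         C_1 X (prod_act (aut_stable_1 X) g f) /\
         h (prod_act (aut_stable_1 X) g f) = horo_act c0 (autV g) (h f)) /\
  (forall s0 : Res_sph X,
     let d := fun s s' : Res_sph X => root_dist R (val s) (val s') in
     exists h : star_prod (Res_sph X) -> {ptws Res_sph X -> R},
       homeomorphism_on (C_sph X) (horofunction_compactification d s0) h /\
       forall (g : building_aut X) (f : star_prod (Res_sph X)), C_sph X f ->
         C_sph X (prod_act (aut_stable_sph X) g f) /\
         h (prod_act (aut_stable_sph X) g f) =
           horo_act s0 (aut_act (aut_stable_sph X) (autV g)) (h f)).

Proof.
split=> [c0|s0]; [exact: chamber_compactification|exact: residue_compactification].
Qed.
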